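(* Let $0<\alpha\le 2$ and let $\omega:[0,\infty)\to[0,\infty)$ be given by $$\omega(t)=\begin{cases}0,&t=0,\\ t(|\log t|^{\alpha}+1),&0<t<e^{-1},\\ \frac{e-2}{e-1}t+\frac1{e-1},&e^{-1}\le t<1,\\ t,&t\ge1.\end{cases}$$ Then the separable Banach spaces $\mathcal F_\omega(c_0)$ and $\ker\beta_\omega\oplus_1 c_0$ are $(\alpha,\alpha)$-almost Lipschitz homeomorphic but not Lipschitz homeomorphic, where $\beta_\omega:\mathcal F_\omega(c_0)\to c_0$ is the barycentric map.
   Context: For a Banach space $X$ with $d(x,y)=\|x-y\|$ and $\omega$ as in the claim (a continuous increasing subadditive function with $\omega(0)=0$ and $\omega(t)\ge t$, so that $\omega\circ d$ is a metric on $X$), $\mathrm{Lip}_\omega(X)$ is the Banach space of functions $g:X\to\mathbb R$ with $g(0)=0$ that are Lipschitz for the metric $\omega\circ d$, normed by the $\omega\circ d$-Lipschitz constant. Its natural predual, the Lipschitz-free space $\mathcal F_\omega(X)$, is the closed linear span in $\mathrm{Lip}_\omega(X)^*$ of the evaluations $\delta_\omega(x):g\mapsto g(x)$, $x\in X$. The barycentric map $\beta_\omega:\mathcal F_\omega(X)\to X$ is the bounded linear quotient map determined by $\beta_\omega(\delta_\omega(x))=x$ for $x\in X$. $Y\oplus_1 Z$ is the direct sum with norm $\|(y,z)\|=\|y\|+\|z\|$. For a map $f$ between metric spaces, $\omega_f(t)=\sup\{d(f(x),f(y)): d(x,y)\le t\}$. For $\alpha>0$, $f$ is $\alpha$-almost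 Lipschitz if there are $A>0$, $t_0>0$ with $\omega_f(t)\le A\,t\,|\log t|^{\alpha}$ for $0<t\le t_0$. Two metric spaces are $(\alpha,\beta)$-almost Lipschitz homeomorphic if there is a bijection $f$ between them such that $f$ is $\alpha$-almost Lipschitz and $f^{-1}$ is $\beta$-almost Lipschitz. They are Lipschitz homeomorphic if there is a bijection $f$ between them such that $f$ and $f^{-1}$ are both Lipschitz. *)

(* Defs.v *)
From HB Require Import structures.
From mathcomp Require Import all_boot all_order all_algebra.
From mathcomp Require Import all_classical all_reals all_analysis.
From mathcomp Require Import lra.
Set Implicit Arguments.
Unset Strict Implicit.
Unset Printing Implicit Defensive.
Import Order.TTheory GRing.Theory Num.Theory.
Import numFieldNormedType.Exports.
Local Open Scope classical_set_scope.
Local Open Scope ring_scope.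

(* The norms of c_0, of Lip_omega and of the dual are all of the form "least
   constant C >= 0 with |L i v| <= C * w i for all i", L i being linear. *)
Section least_constant_norm.
Context (R : realType) (V : lmodType R) (I : Type) (L : I -> V -> R).
Context (w : I -> R) (N : V -> R).
Hypothesis L_lin : forall i a u v, L i (a *: u + v) = a * L i u + L i v.
Hypothesis N_ge0 : forall v, 0 <= N v.
Hypothesis N_bound : forall v i, `|L i v| <= N v * w i.
Hypothesis N_least : forall v C, 0 <= C ->
  (forall i, `|L i v| <= C * w i) -> N v <= C.

Lemma least_constantD u v : N (u + v) <= N u + N v.
Proof.
apply: N_least => [|i]; first exact: addr_ge0.
have -> : L i (u + v) = L i u + L i v by rewrite -[u]scale1r L_lin mul1r scale1r.
by rewrite (le_trans (ler_normD _ _))// mulrDl lerD.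
Qed.

Let L0 i : L i 0 = 0.
Proof.
have := L_lin i 1 0 0; rewrite scale1r addr0 mul1r => /eqP.
by rewrite -subr_eq subrr => /eqP.
Qed.

Let LZ i a v : L i (a *: v) = a * L i v.
Proof. by rewrite -[a *: v]addr0 L_lin L0 addr0. Qed.

Let N_leZ a v : N (a *: v) <= `|a| * N v.
Proof.
apply: N_least => [|i]; first exact: mulr_ge0.
by rewrite LZ normrM -mulrA ler_wpM2l.
Qed.

Lemma least_constantZ a v : N (a *: v) = `|a| * N v.
Proof.
have [->|a0] := eqVneq a 0.
  by apply/eqP; rewrite eq_le N_leZ normr0 mul0r N_ge0.
apply/eqP; rewrite eq_le N_leZ/= -ler_pdivlMl ?normr_gt0//.
by rewrite -{1}[v](scalerK a0) -normfV N_leZ.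
Qed.

Lemma least_constant0 v : N v = 0 -> forall i, L i v = 0.
Proof.
move=> Nv i; apply/eqP; rewrite -normr_le0.
by rewrite (le_trans (N_bound _ _))// Nv mul0r.
Qed.

End least_constant_norm.

Section c0.
Context (R : realType).

Definition c0_pred : {pred nat -> R} := mem [set u : nat -> R | u @ \oo --> (0 : R)].

Fact c0_submod_closed : submod_closed c0_pred.
Proof.
split; first by apply/mem_set; exact: cvg_cst.
move=> a u v /set_mem/= u0 /set_mem/= v0; apply/mem_set => /=.
rewrite -[0](addr0 (0 : R)) -{1}(scaler0 R a).
by apply: cvgD => //; exact: cvgZr.
Qed.
HB.instance Definition _ := GRing.isSubmodClosed.Build R (nat -> R) c0_pred
  c0_submod_closed.

Record c0 := C0 { c0_fun :> nat -> R; c0_funP : c0_fun \in c0_pred }.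
HB.instance Definition _ := [isSub for c0_fun].
HB.instance Definition _ := [Choice of c0 by <:].
HB.instance Definition _ := [SubChoice_isSubLmodule of c0 by <:].

Lemma c0_cvg (u : c0) : u n @[n --> \oo] --> (0 : R).
Proof. exact/set_mem/c0_funP. Qed.

Definition c0_norm (u : c0) : R := sup [set `|u n| | n in [set: nat]].

Let c0_ubound (u : c0) : has_ubound [set `|u n| | n in [set: nat]].
Proof.
have [M [_ uM]] := cvg_seq_bounded (cvgP _ (@c0_cvg u)).
by exists (M + 1) => _ [n _ <-]; apply: uM => //; rewrite ltrDl.
Qed.

Let c0_norm_ge0 u : 0 <= c0_norm u.
Proof.
apply: (le_trans (normr_ge0 (u 0%N))).
by apply: (ub_le_sup (@c0_ubound u)); exists 0%N.
Qed.

Lemma c0_norm_ub (u : c0) n : `|u n| <= c0_norm u * 1.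
Proof. by rewrite mulr1; apply: (ub_le_sup (@c0_ubound u)); exists n. Qed.

Let c0_norm_least (u : c0) C : 0 <= C ->
  (forall n, `|u n| <= C * 1) -> c0_norm u <= C.
Proof.
move=> _ uC; apply: ge_sup; first by exists `|u 0%N|, 0%N.
by move=> _ [n _ <-]; rewrite (le_trans (uC n))// mulr1.
Qed.

Let c0_lin n a (u v : c0) : (a *: u + v) n = a * u n + v n.
Proof. by []. Qed.

Let c0_norm_eq0 u : c0_norm u = 0 -> u = 0.
Proof.
move=> /(least_constant0 c0_norm_ub) u0.
by apply: val_inj; apply/funext => n; rewrite /= u0.
Qed.

HB.instance Definition _ := Lmodule_isNormed.Build R c0
  (least_constantD c0_lin c0_norm_ge0 c0_norm_ub c0_norm_least)
  (least_constantZ c0_lin c0_norm_ge0 c0_norm_ub c0_norm_least)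
  c0_norm_eq0.

End c0.

Section lip.
Context (R : realType) (omega : R -> R) (X : normedModType R).

Definition omega_lipschitz (C : R) (g : X -> R) :=
  forall x y, `|g x - g y| <= C * omega `|x - y|.

Definition lip_pred : {pred X -> R} := mem [set g : X -> R |
  g 0 = 0 /\ exists2 C, 0 <= C & omega_lipschitz C g].

Fact lip_submod_closed : submod_closed lip_pred.
Proof.
split.
  apply/mem_set; split => //; exists 0 => // x y.
  by rewrite subrr normr0 mul0r.
move=> a f g /set_mem/= [f0 [C C0 fC]] /set_mem/= [g0 [D D0 gD]].
apply/mem_set; split => /=.
  by rewrite -[LHS]/(a * f 0 + g 0) f0 g0 mulr0 addr0.
exists (`|a| * C + D); first by rewrite addr_ge0// mulr_ge0.
move=> x y; rewrite -[X in `|X|]/(a * f x + g x - (a * f y + g y)).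
rewrite opprD addrACA -mulrBr (le_trans (ler_normD _ _))// normrM mulrDl.
by rewrite lerD// -mulrA ler_wpM2l.
Qed.
HB.instance Definition _ := GRing.isSubmodClosed.Build R (X -> R) lip_pred
  lip_submod_closed.

Record lip := Lip { lip_fun :> X -> R; lip_funP : lip_fun \in lip_pred }.
HB.instance Definition _ := [isSub for lip_fun].
HB.instance Definition _ := [Choice of lip by <:].
HB.instance Definition _ := [SubChoice_isSubLmodule of lip by <:].

Definition lip_norm (g : lip) : R :=
  inf [set C | 0 <= C /\ omega_lipschitz C g].

Let lip_constants (g : lip) : [set C | 0 <= C /\ omega_lipschitz C g] !=set0.
Proof. by have /set_mem/= [_ [C C0 gC]] := lip_funP g; exists C. Qed.

Let lip_constants_lb (g : lip) :
  has_lbound [set C | 0 <= C /\ omega_lipschitz C g].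
Proof. by exists 0 => C []. Qed.

Let lip_norm_ge0 g : 0 <= lip_norm g.
Proof. by apply: lb_le_inf => // C []. Qed.

Let lip_norm_least (g : lip) C : 0 <= C ->
  (forall p : X * X, `|g p.1 - g p.2| <= C * omega `|p.1 - p.2|) ->
  lip_norm g <= C.
Proof.
by move=> C0 gC; apply: ge_inf => //; split=> // x y; exact: (gC (x, y)).
Qed.

Let lip_norm_bound (g : lip) (p : X * X) :
  `|g p.1 - g p.2| <= lip_norm g * omega `|p.1 - p.2|.
Proof.
set w := omega _; have [w0|w0] := leP w 0.
  have [C [C0 gC]] := lip_constants g.
  have : lip_norm g <= C by exact: ge_inf.
  by move=> /(ler_wnM2r w0); apply: le_trans (gC _ _).
rewrite -ler_pdivrMr//; apply: lb_le_inf => // C [C0 gC].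
by rewrite ler_pdivrMr// gC.
Qed.

Lemma lip_normP (g : lip) : omega_lipschitz (lip_norm g) g.
Proof. by move=> x y; exact: (lip_norm_bound g (x, y)). Qed.

Lemma lip0 (g : lip) : g 0 = 0.
Proof. by have /set_mem/= [] := lip_funP g. Qed.

Let lip_lin (p : X * X) a (f g : lip) :
  (a *: f + g) p.1 - (a *: f + g) p.2 =
  a * (f p.1 - f p.2) + (g p.1 - g p.2).
Proof.
rewrite -[LHS]/(a * f p.1 + g p.1 - (a * f p.2 + g p.2)).
by rewrite mulrBr opprD addrACA.
Qed.

Let lip_norm_eq0 g : lip_norm g = 0 -> g = 0.
Proof.
move=> /(least_constant0 lip_norm_bound) g0.
apply: val_inj; apply/funext => x /=.
by have /= := g0 (x, 0); rewrite lip0 subr0.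
Qed.

HB.instance Definition _ := Lmodule_isNormed.Build R lip
  (least_constantD lip_lin lip_norm_ge0 lip_norm_bound lip_norm_least)
  (least_constantZ lip_lin lip_norm_ge0 lip_norm_bound lip_norm_least)
  lip_norm_eq0.

End lip.

Section cdual.
Context (R : realType) (V : normedModType R).

Definition cdual_pred : {pred V -> R} :=
  mem [set phi : V -> R | linear phi /\ continuous phi].

Fact cdual_submod_closed : submod_closed cdual_pred.
Proof.
split.
  apply/mem_set; split; last by move=> x; exact: cvg_cst.
  by move=> a x y; rewrite -[LHS]/(0 : R) -[RHS]/(a *: 0 + 0 : R) scaler0 addr0.
move=> a f g /set_mem/= [lf cf] /set_mem/= [lg cg].
apply/mem_set; split => /=.
  move=> b x y; rewrite -![(a *: f + g) _]/(a *: f _ + g _) lf lg.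
  by rewrite !scalerDr addrACA !scalerA (mulrC a b).
by move=> x; apply: cvgD; [apply: cvgZr; exact: cf|exact: cg].
Qed.
HB.instance Definition _ := GRing.isSubmodClosed.Build R (V -> R) cdual_pred
  cdual_submod_closed.

Record cdual := CDual { cdual_fun :> V -> R; cdual_funP : cdual_fun \in cdual_pred }.
HB.instance Definition _ := [isSub for cdual_fun].
HB.instance Definition _ := [Choice of cdual by <:].
HB.instance Definition _ := [SubChoice_isSubLmodule of cdual by <:].

Lemma cdual_linear (phi : cdual) : linear phi.
Proof. by have /set_mem/= [] := cdual_funP phi. Qed.

Lemma cdual_continuous (phi : cdual) : continuous phi.
Proof. by have /set_mem/= [] := cdual_funP phi. Qed.

HB.instance Definition _ (phi : cdual) :=
  GRing.isLinear.Build R V R *:%R phi (@cdual_linear phi).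

Definition cdual_norm (phi : cdual) : R :=
  sup [set `|phi v| | v in [set v | `|v| <= 1]].

Let cdual_ubound (phi : cdual) :
  has_ubound [set `|phi v| | v in [set v | `|v| <= 1]].
Proof.
have /linear_bounded_continuous/linear_boundedP := @cdual_continuous phi.
move=> /pinfty_ex_gt0[M M0 phiM].
exists M => _ [v /= v1 <-]; rewrite (le_trans (phiM v))//.
by rewrite -[leRHS]mulr1 ler_wpM2l// ltW.
Qed.

Let cdual_norm_ge0 phi : 0 <= cdual_norm phi.
Proof.
apply: (le_trans (normr_ge0 (phi 0))).
by apply: (ub_le_sup (@cdual_ubound phi)); exists 0 => //=; rewrite normr0.
Qed.

Let unit_ball := {v : V | `|v| <= 1}.

Let cdual_norm_ub (phi : cdual) (v : unit_ball) :
  `|phi (sval v)| <= cdual_norm phi * 1.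
Proof.
rewrite mulr1; apply: (ub_le_sup (@cdual_ubound phi)).
by exists (sval v) => //; exact: (svalP v).
Qed.

Let cdual_norm_least (phi : cdual) C : 0 <= C ->
  (forall v : unit_ball, `|phi (sval v)| <= C * 1) -> cdual_norm phi <= C.
Proof.
move=> C0 phiC; apply: ge_sup.
  by exists `|phi 0|, 0 => //=; rewrite normr0.
by move=> _ [v v1 <-]; have := phiC (exist _ v v1); rewrite mulr1.
Qed.

Let cdual_lin (v : unit_ball) a (phi psi : cdual) :
  (a *: phi + psi) (sval v) = a * phi (sval v) + psi (sval v).
Proof. by []. Qed.

Let cdual_norm_bound (phi : cdual) v : `|phi v| <= cdual_norm phi * `|v|.
Proof.
have [->|v0] := eqVneq v 0; first by rewrite linear0 !normr0 mulr0.
have nv0 : 0 < `|v| by rewrite normr_gt0.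
have u1 : `| `|v|^-1 *: v| <= 1.
  by rewrite normrZ normfV normr_id mulVf// gt_eqF.
have := cdual_norm_ub phi (exist (fun v : V => `|v| <= 1) _ u1).
by rewrite /= linearZ/= normrM normfV normr_id mulr1 mulrC ler_pdivrMr.
Qed.

Let cdual_norm_eq0 phi : cdual_norm phi = 0 -> phi = 0.
Proof.
move=> phi0; apply: val_inj; apply/funext => v /=; apply/eqP.
by rewrite -normr_le0 (le_trans (cdual_norm_bound _ _))// phi0 mul0r.
Qed.

HB.instance Definition _ := Lmodule_isNormed.Build R cdual
  (least_constantD cdual_lin cdual_norm_ge0 cdual_norm_ub cdual_norm_least)
  (least_constantZ cdual_lin cdual_norm_ge0 cdual_norm_ub cdual_norm_least)
  cdual_norm_eq0.

Lemma cdual_normP (phi : cdual) v : `|phi v| <= `|phi| * `|v|.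
Proof. exact: cdual_norm_bound. Qed.

End cdual.

Section closed_span.
Context (R : realType) (V : normedModType R).

Definition lin_span (A : set V) : set V := [set v | exists n (a : 'I_n -> R)
  (x : 'I_n -> V), (forall i, A (x i)) /\ v = \sum_(i < n) a i *: x i].

Definition closed_span (A : set V) : set V := closure (lin_span A).

Lemma lin_span_lin A a u v : lin_span A u -> lin_span A v ->
  lin_span A (a *: u + v).
Proof.
move=> [m [b [x [Ax ->]]]] [n [c [y [Ay ->]]]].
exists (m + n)%N,
  (fun i => match fintype.split i with inl j => a * b j | inr k => c k end),
  (fun i => match fintype.split i with inl j => x j | inr k => y k end); split.
  by move=> i; case: fintype.split.
rewrite big_split_ord/= scaler_sumr; congr (_ + _); apply: eq_bigr => i _.
  by rewrite (unsplitK (inl i)) scalerA.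
by rewrite (unsplitK (inr i)).
Qed.

Lemma lin_span0 A : lin_span A 0.
Proof.
by exists 0%N, (fun=> 0), (fun=> 0); split; [case|rewrite big_ord0].
Qed.

Lemma closed_span_sub A : A `<=` closed_span A.
Proof.
move=> v Av; apply: subset_closure; exists 1%N, (fun=> 1), (fun=> v).
by split=> //; rewrite big_ord1 scale1r.
Qed.

Lemma closureP (B : set V) v :
  closure B v <-> forall e, 0 < e -> exists2 u, B u & `|v - u| < e.
Proof.
split=> [clv e e0|Bv W /nbhs_ballP[e /= e0 vW]].
  have [u [Bu]] := clv _ (nbhsx_ballx v e e0).
  by rewrite -ball_normE; exists u.
have [u Bu vu] := Bv e e0; exists u; split=> //.
by apply: vW; rewrite -ball_normE.
Qed.

Lemma closed_span_lin A a u v : closed_span A u -> closed_span A v ->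
  closed_span A (a *: u + v).
Proof.
move=> /closureP uA /closureP vA; apply/closureP => e e0.
have k0 : 0 < `|a| + 1 by rewrite ltr_wpDl.
have e20 : 0 < e / 2 by rewrite divr_gt0.
have [u' Au' uu'] := uA _ (divr_gt0 e20 k0).
have [v' Av' vv'] := vA _ e20.
exists (a *: u' + v'); first exact: lin_span_lin.
rewrite opprD addrACA -scalerBr (le_lt_trans (ler_normD _ _))//.
rewrite (splitr e) ler_ltD// normrZ (le_trans (ler_wpM2l _ (ltW uu')))//.
by rewrite mulrA ler_pdivrMr// mulrC ler_wpM2l ?lerDl// ltW.
Qed.

(* the finite combinations of elements of A reduce a closed linear condition
   on closed_span A to a condition on A *)
Lemma closed_span_ind A (P : set V) : closed P -> P 0 ->
  (forall a u v, P u -> P v -> P (a *: u + v)) -> A `<=` P ->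
  closed_span A `<=` P.
Proof.
move=> clP P0 Plin AP; rewrite (closure_id P).1//; apply: closureS.
move=> _ [n [a [x [Ax ->]]]]; elim/big_ind: _ => //.
- by move=> u v Pu Pv; rewrite -[u]scale1r; exact: Plin.
- by move=> i _; rewrite -[_ *: _]addr0; apply: Plin => //; exact/AP/Ax.
Qed.

End closed_span.

Section sub_normed.
Context (R : realType) (V : normedModType R) (W : lmodType R) (f : {linear W -> V}).
Hypothesis f_inj : injective f.

Lemma sub_normD u v : `|f (u + v)| <= `|f u| + `|f v|.
Proof. by rewrite linearD ler_normD. Qed.

Lemma sub_normZ a v : `|f (a *: v)| = `|a| * `|f v|.
Proof. by rewrite linearZ normrZ. Qed.

Lemma sub_norm0 v : `|f v| = 0 -> v = 0.
Proof. by move/normr0_eq0; rewrite -(linear0 f) => /f_inj. Qed.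

End sub_normed.

Section lipfree.
Context (R : realType) (omega : R -> R) (X : normedModType R).

Fact eval_in_cdual (x : X) :
  (fun g : lip omega X => g x) \in @cdual_pred R (lip omega X).
Proof.
pose ev (g : lip omega X) : R := g x.
have lev : linear ev by [].
pose evL : {linear lip omega X -> R} :=
  HB.pack ev (GRing.isLinear.Build _ _ _ _ _ lev).
apply/mem_set; split => //.
apply: (@bounded_linear_continuous _ _ _ evL).
apply/linear_boundedP; near=> M => g.
have := lip_normP g x 0; rewrite lip0 !subr0 => /le_trans; apply.
rewrite -[lip_norm g]/(`|g|) [leRHS]mulrC.
apply: ler_wpM2l; first by [].
by near: M; apply: nbhs_pinfty_ge; exact: num_real.
Unshelve. all: by end_near. Qed.

Definition eval (x : X) : cdual (lip omega X) := CDual (eval_in_cdual x).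

Definition lipfree_pred : {pred cdual (lip omega X)} :=
  mem (closed_span (range eval)).

Fact lipfree_submod_closed : submod_closed lipfree_pred.
Proof.
split; first by apply/mem_set/subset_closure/lin_span0.
move=> a u v /set_mem uF /set_mem vF; apply/mem_set.
exact: closed_span_lin.
Qed.
HB.instance Definition _ := GRing.isSubmodClosed.Build R (cdual (lip omega X))
  lipfree_pred lipfree_submod_closed.

Record lipfree := LipFree {
  lipfree_val :> cdual (lip omega X);
  lipfree_valP : lipfree_val \in lipfree_pred }.
HB.instance Definition _ := [isSub for lipfree_val].
HB.instance Definition _ := [Choice of lipfree by <:].
HB.instance Definition _ := [SubChoice_isSubLmodule of lipfree by <:].
HB.instance Definition _ := Lmodule_isNormed.Build R lipfree
  (sub_normD (val : {linear lipfree -> _})) (sub_normZ (val : {linear lipfree -> _}))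
  (sub_norm0 (f := (val : {linear lipfree -> _})) val_inj).

Fact delta_in_lipfree (x : X) : eval x \in lipfree_pred.
Proof. by apply/mem_set/closed_span_sub; exists x. Qed.

Definition delta (x : X) : lipfree := LipFree (delta_in_lipfree x).

Definition is_barycentric (beta : {linear lipfree -> X}) :=
  continuous beta /\ forall x, beta (delta x) = x.

End lipfree.

Section barycentric_uniq.
Context (R : realType) (omega : R -> R) (X : normedModType R).

Lemma is_barycentric_uniq (b1 b2 : {linear lipfree omega X -> X}) :
  is_barycentric b1 -> is_barycentric b2 -> b1 =1 b2.
Proof.
move=> [c1 d1] [c2 d2] phi.
have /linear_bounded_continuous/linear_boundedP/pinfty_ex_gt0[M1 M10 b1M] := c1.
have /linear_bounded_continuous/linear_boundedP/pinfty_ex_gt0[M2 M20 b2M] := c2.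
apply/eqP; rewrite -subr_eq0 -normr_le0; apply/ler_addgt0Pl => e e0.
have M0 : 0 < M1 + M2 by rewrite addr_gt0.
have /set_mem/closureP := lipfree_valP phi.
move=> /(_ _ (divr_gt0 e0 M0))[_ [n [a [x [Ax ->]]]] phix].
have /choice[y xy] : forall i, exists y, eval omega y = x i.
  by move=> i; have [y _ <-] := Ax i; exists y.
pose u := \sum_(i < n) a i *: delta omega (y i).
have bu : b1 u = b2 u.
  by rewrite !linear_sum; apply: eq_bigr => i _; rewrite !linearZ/= d1 d2.
have valu : \val u = \sum_(i < n) a i *: x i.
  rewrite /u raddf_sum; apply: eq_bigr => i _.
  by rewrite -xy.
have phiu : `|phi - u| < e / (M1 + M2).
  by move: phix; rewrite -valu.
have -> : b1 phi - b2 phi = b1 (phi - u) - b2 (phi - u).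
  by rewrite (linearB b1) (linearB b2) bu opprB addrA subrK.
rewrite (le_trans (ler_normB _ _))// (le_trans (lerD (b1M _) (b2M _)))//.
by rewrite -mulrDl addr0 mulrC -ler_pdivlMr// ltW.
Qed.

End barycentric_uniq.

Section omega.
Context (R : realType).

(* omega is only evaluated at norms, so its values on negative numbers (0) are
   irrelevant *)
Definition omega (alpha t : R) : R :=
  if t <= 0 then 0
  else if t < expR (- 1) then t * (`|ln t| `^ alpha + 1)
  else if t < 1 then (expR 1 - 2) / (expR 1 - 1) * t + (expR 1 - 1)^-1
  else t.

Lemma omega_ge alpha t : 0 <= t -> t <= omega alpha t.
Proof.
rewrite /omega; case: ifPn => [? ?|]; first by [].
rewrite -ltNge => t0 _; case: ifPn => _.
  by rewrite -[leLHS]mulr1 ler_wpM2l ?lerDr ?powR_ge0 ?ltW.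
case: ifPn => // t1.
have e1 : 0 < expR 1 - 1 :> R by rewrite subr_gt0 expR_gt1.
rewrite [leRHS](_ : _ = ((expR 1 - 2) * t + 1) / (expR 1 - 1)).
  rewrite ler_pdivlMr//.
  have : 0 <= 1 - t by rewrite subr_ge0 ltW.
  lra.
by rewrite [RHS]mulrDl mul1r [in RHS]mulrAC.
Qed.

End omega.

Section barycentric.
Context (R : realType) (alpha : R).
Local Notation F := (lipfree (omega alpha) (c0 R)).

Let coord_lipschitz n :
  omega_lipschitz (omega alpha) 1 (fun u : c0 R => u n).
Proof.
move=> u v; rewrite mul1r (le_trans _ (omega_ge alpha (normr_ge0 (u - v))))//.
by have := c0_norm_ub (u - v) n; rewrite mulr1.
Qed.

Fact coord_in_lip n :
  (fun u : c0 R => u n) \in lip_pred (omega alpha) (X := c0 R).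
Proof. by apply/mem_set; split => //; exists 1. Qed.

Definition coord n : lip (omega alpha) (c0 R) := Lip (coord_in_lip n).

Let coord_norm n : `|coord n| <= 1.
Proof.
apply: ge_inf; first by exists 0 => C [].
by split=> //; exact: coord_lipschitz.
Qed.

Let coord_le (phi : cdual (lip (omega alpha) (c0 R))) n : `|phi (coord n)| <= `|phi|.
Proof.
by rewrite (le_trans (cdual_normP _ _))// -[leRHS]mulr1 ler_wpM2l.
Qed.

Fact barycenter_in_c0 (phi : F) : (fun n => phi (coord n)) \in @c0_pred R.
Proof.
apply/mem_set => /=.
pose P : set (cdual (lip (omega alpha) (c0 R))) :=
  [set psi | psi (coord n) @[n --> \oo] --> (0 : R)].
suff : closed_span (range (eval (omega alpha) (X := c0 R))) `<=` P.
  by apply; exact/set_mem/lipfree_valP.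
apply: closed_span_ind.
- move=> psi /closureP Ppsi; apply/cvgr0Pnorm_lt => e e0.
  have e20 : 0 < e / 2 by rewrite divr_gt0.
  have [xi /= /cvgr0Pnorm_lt/(_ _ e20) xi0 psixi] := Ppsi _ e20.
  near=> n; rewrite -(subrK xi psi).
  rewrite -[X in `|X|]/((psi - xi) (coord n) + xi (coord n)).
  rewrite (le_lt_trans (ler_normD _ _))// (splitr e) ltrD//.
    by rewrite (le_lt_trans (coord_le _ _)).
  by near: n.
- exact: cvg_cst.
- move=> a u v u0 v0; rewrite /P/= -[0](addr0 (0 : R)) -{1}(scaler0 R a).
  by apply: cvgD => //; exact: cvgZr.
- by move=> _ [u _ <-]; exact: c0_cvg.
Unshelve. all: by end_near. Qed.

Let beta (phi : F) : c0 R := C0 (barycenter_in_c0 phi).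

Let beta_linear : linear beta.
Proof. by move=> a phi psi; apply: val_inj. Qed.

(* (beta phi)_n = phi (e_n^* ) *)
Lemma barycentric_exists : exists b : {linear F -> c0 R}, is_barycentric b.
Proof.
pose b : {linear F -> c0 R} :=
  HB.pack beta (GRing.isLinear.Build _ _ _ _ _ beta_linear).
exists b; split; last by move=> u; apply: val_inj.
apply/linear_bounded_continuous/linear_boundedP; near=> M => phi.
apply: (@le_trans _ _ `|phi|).
  apply: ge_sup; first by exists `|phi (coord 0%N)|, 0%N.
  by move=> _ [n _ <-]; exact: coord_le.
by rewrite -[leLHS]mul1r ler_wpM2r//; near: M; apply: nbhs_pinfty_ge; exact: num_real.
Unshelve. all: by end_near. Qed.

Definition barycentric : {linear F -> c0 R} := projT1 (cid barycentric_exists).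

Lemma barycentricP : is_barycentric barycentric.
Proof. exact: (projT2 (cid barycentric_exists)). Qed.

End barycentric.

Section lin_ker.
Context (R : realType) (V : normedModType R) (W : lmodType R).
Context (f : {linear V -> W}).

Definition lin_ker_pred : {pred V} := mem [set v | f v = 0].

Fact lin_ker_submod_closed : submod_closed lin_ker_pred.
Proof.
split; first by apply/mem_set; exact: linear0.
move=> a u v /set_mem/= fu /set_mem/= fv; apply/mem_set => /=.
by rewrite linearP fu fv scaler0 addr0.
Qed.
HB.instance Definition _ := GRing.isSubmodClosed.Build R V lin_ker_pred
  lin_ker_submod_closed.

Record lin_ker := LinKer {
  lin_ker_val :> V; lin_ker_valP : lin_ker_val \in lin_ker_pred }.
HB.instance Definition _ := [isSub for lin_ker_val].
HB.instance Definition _ := [Choice of lin_ker by <:].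
HB.instance Definition _ := [SubChoice_isSubLmodule of lin_ker by <:].
HB.instance Definition _ := Lmodule_isNormed.Build R lin_ker
  (sub_normD (val : {linear lin_ker -> _}))
  (sub_normZ (val : {linear lin_ker -> _}))
  (sub_norm0 (f := (val : {linear lin_ker -> _})) val_inj).

End lin_ker.

(* the library norms V * W with the maximum, hence the alias *)
Definition l1sum (R : realType) (V W : normedModType R) : Type := (V * W)%type.

Section l1sum.
Context (R : realType) (V W : normedModType R).

HB.instance Definition _ := GRing.Lmodule.copy (l1sum V W) (V * W)%type.

Definition l1sum_norm (z : l1sum V W) : R := `|z.1| + `|z.2|.

Let l1sum_normD y z : l1sum_norm (y + z) <= l1sum_norm y + l1sum_norm z.
Proof. by rewrite /l1sum_norm addrACA lerD// ler_normD. Qed.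

Let l1sum_normZ a z : l1sum_norm (a *: z) = `|a| * l1sum_norm z.
Proof. by rewrite /l1sum_norm !normrZ mulrDr. Qed.

Let l1sum_norm0 z : l1sum_norm z = 0 -> z = 0.
Proof.
move/eqP; rewrite paddr_eq0// !normr_eq0 => /andP[/eqP z1 /eqP z2].
by case: z z1 z2 => /= ? ? -> ->.
Qed.

HB.instance Definition _ := Lmodule_isNormed.Build R (l1sum V W)
  l1sum_normD l1sum_normZ l1sum_norm0.

End l1sum.

Definition separable (T : topologicalType) :=
  exists2 S : set T, countable S & dense S.

Definition banach (R : realType) (V : normedModType R) :=
  forall F : set_system V, ProperFilter F -> cauchy F -> cvg F.

Section homeomorphisms.
Context (R : realType).
Implicit Types V W : normedModType R.

Definition modulus V W (f : V -> W) (t : R) : \bar R :=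
  ereal_sup [set `|f p.1 - f p.2|%:E | p in [set p : V * V | `|p.1 - p.2| <= t]].

Definition almost_lipschitz V W (alpha : R) (f : V -> W) :=
  exists A t0 : R, [/\ 0 < A, 0 < t0 & forall t, 0 < t <= t0 ->
    (modulus f t <= (A * t * `|ln t| `^ alpha)%:E)%E].

Definition almost_lipschitz_homeomorphic (alpha beta : R) V W :=
  exists (f : V -> W) (g : W -> V), [/\ cancel f g, cancel g f,
    almost_lipschitz alpha f & almost_lipschitz beta g].

Definition lipschitz_homeomorphic V W :=
  exists (f : V -> W) (g : W -> V),
    [/\ cancel f g, cancel g f, lipschitz f & lipschitz g].

End homeomorphisms.

(* Main.v *)
Require Import Defs.
From HB Require Import structures.
From mathcomp Require Import all_boot all_order all_algebra.
From mathcomp Require Import all_classical all_reals all_analysis.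
From mathcomp Require Import lra ring.
Set Implicit Arguments.
Unset Strict Implicit.
Unset Printing Implicit Defensive.
Import Order.TTheory GRing.Theory Num.Theory.
Import numFieldNormedType.Exports.
Local Open Scope classical_set_scope.
Local Open Scope ring_scope.

(** Let F be the free space and beta : F -> c_0 the barycentric map. The map
delta : c_0 -> F is a right inverse of beta whose modulus of continuity is at
most omega, so z |-> (z - delta (beta z), beta z) is a bijection of F onto
ker beta (+) c_0 with inverse (k, x) |-> k + delta x. Both maps have modulus at
most 2 t + omega t, which is O(t |ln t|^alpha) near 0; they also carry
separability from F to the direct sum. Completeness holds because c_0 and dual
spaces carry least-constant norms, and it passes to closed subspaces and to
sums.

The substance is that the two spaces are not Lipschitz homeomorphic: the sum
contains c_0 isometrically, and c_0 has no bi-Lipschitz copy in the free space of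
any normed space X for a gauge w with w(t) / t -> oo at 0
([c0_not_lipschitz_embeddable]). The proof plays with approximate metric
midpoints. In c_0 the points u_n = (x + y) / 2 + (|x - y| / 2) e_n are
almost midpoints of x and y, and are |x - y| / 2 apart ([c0_midpoints]). If
x, y almost realise the Lipschitz constant L of h, then the points h(u_n) are
almost midpoints of h x and h y; were such midpoints almost precompact, two of
the h(u_n) would be much closer than |x - y|, against the lower Lipschitz bound.

Approximate midpoints of an arbitrary pair in a free space need not be
precompact, and the pair is chosen to satisfy two extremality conditions at once
([penalised_maximal_pair]). First, some functional g of norm 1, Lipschitz for
the original norm of X and with bounded support, has slope almost L on x, y.
As w is steep at 0, g is negligible against w at small distances, so g + f and
g - f have norm almost 1 whenever f has norm 1 and is either uniformly tiny or
supported far away. Testing h x - h u on g - f and h u - h y on g + f then shows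
that the defect 2 h u - (h x + h y) of a midpoint u almost vanishes on such f
([midpoint_defect]). Secondly, x, y is almost extremal for the slope with a
small multiple of a functional q added, q being A-Lipschitz for w and bounded
by 1. Here A is so large that q can be cut off outside the d-neighbourhood of
a finite set E nearly carrying h x - h y and replaced by an arbitrary function
beyond the 2 d-neighbourhood; hence the defect almost vanishes on functions that
are zero near E ([tightness]). The radius d is fixed before the pair, only
E depends on it, so the second error can be made as small as needed.

Finally every test function of norm 1 splits into a tiny part, a far part and a
part that is K-Lipschitz for the norm of X ([lip_decomposition]). Two K-Lipschitz
functions that are close on E are close near E, and, w being steep, even in the
w-Lipschitz norm there ([lipfree_act_close]). So, up to small errors, the
functionals h(u_n) are determined by finitely many bounded numbers, and the
pigeonhole principle yields two of them that nearly agree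
([near_midpoints_collapse]). *)

(** * Gauges *)

(** The two-sided bound is what the estimates below use of a modulus w; the
square root only serves as a convenient function that is o(1) at 0 and o(t) at
infinity. *)
Definition gauge (R : realType) (w : R -> R) :=
  (forall t, 0 <= t -> t <= w t) /\
  (forall t, 0 <= t -> w t <= t + 4 * Num.sqrt t).

(** This is w(t) / t -> oo as t -> 0, without dividing. *)
Definition steep (R : realType) (w : R -> R) := forall K, exists2 s : R, 0 < s &
  forall t, 0 <= t -> t <= s -> K * t <= w t.

Lemma steepM (R : realType) (w : R -> R) K t : steep w -> 0 < t ->
  exists2 s : R, 0 < s & forall a, 0 <= a -> a <= s -> K * a <= t * w a.
Proof.
move=> w_steep t0; have [s s0 ws] := w_steep (K / t).
exists s => // a a0 as_; have := ws a a0 as_.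
by rewrite mulrAC ler_pdivrMr// [w a * t]mulrC.
Qed.

(** * Lipschitz functions for a gauge *)

Section clamp.
Context (R : realType).
Implicit Types a b v w M : R.

(** Truncation at a variable level; unlike multiplication by a cut-off function
it does not increase Lipschitz constants. *)
Definition clamp a v := Num.max (- v) (Num.min a v).

Lemma clamp_dist a b v w M : `|a - b| <= M -> `|v - w| <= M ->
  `|clamp a v - clamp b w| <= M.
Proof.
rewrite /clamp !ler_distl => /andP[? ?] /andP[? ?].
by apply/andP; split; rewrite /Num.max /Num.min; do ![case: ifPn => //];
  rewrite -?leNgt; lra.
Qed.

Lemma clamp_id a v : `|a| <= v -> clamp a v = a.
Proof.
rewrite ler_norml => /andP[? ?].
by rewrite /clamp (min_idPl _)// (max_idPr _).
Qed.

Lemma clamp_norm a v : 0 <= v -> `|clamp a v| <= v.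
Proof.
move=> v0; rewrite ler_norml /clamp le_max lexx/= ge_max ge_min lexx orbT andbT.
lra.
Qed.

Lemma clamp_le a v : 0 <= v -> `|clamp a v| <= `|a|.
Proof.
move=> v0; have [/clamp_id->//|va] := leP `|a| v.
by rewrite (le_trans (clamp_norm _ v0))// ltW.
Qed.

Lemma clamp_sub_le a v : 0 <= v -> `|a - clamp a v| <= `|a|.
Proof.
move=> v0; have [/clamp_id->|] := leP `|a| v; first by rewrite subrr normr0.
rewrite ltr_normr /clamp => /orP[va|va].
  rewrite (min_idPr (ltW va)) (max_idPr _); last lra.
  by rewrite !ger0_norm; lra.
rewrite (min_idPl _); last lra.
rewrite (max_idPl _); last lra.
by rewrite !ler0_norm; lra.
Qed.

Lemma clamp0 v : 0 <= v -> clamp 0 v = 0.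
Proof. by move=> v0; rewrite clamp_id// normr0. Qed.

Lemma clampv0 a : clamp a 0 = 0.
Proof. by apply/eqP; rewrite -normr_le0 clamp_norm. Qed.

End clamp.

Section lipschitz_functions.
Context (R : realType) (X : normedModType R).
Implicit Types (w : R -> R) (f g : X -> R) (C D : R).

Lemma omega_lipschitz_le w C D f : (forall t, 0 <= t -> 0 <= w t) -> C <= D ->
  omega_lipschitz w C f -> omega_lipschitz w D f.
Proof. by move=> w0 CD fC x y; rewrite (le_trans (fC x y))// ler_wpM2r// w0. Qed.

Lemma omega_lipschitzD w C D f g : omega_lipschitz w C f ->
  omega_lipschitz w D g -> omega_lipschitz w (C + D) (f \+ g).
Proof.
move=> fC gD x y; have := fC x y; have := gD x y; rewrite !ler_norml /=.
by move=> /andP[? ?] /andP[? ?]; apply/andP; split; lra.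
Qed.

Lemma omega_lipschitzN w C f : omega_lipschitz w C f ->
  omega_lipschitz w C (\- f).
Proof. by move=> fC x y; rewrite /= -opprD normrN. Qed.

Lemma omega_lipschitzB w C D f g : omega_lipschitz w C f ->
  omega_lipschitz w D g -> omega_lipschitz w (C + D) (f \- g).
Proof.
by move=> fC gD; apply: (omega_lipschitzD fC (omega_lipschitzN gD)).
Qed.

Lemma omega_lipschitzZ w a C f : omega_lipschitz w C f ->
  omega_lipschitz w (`|a| * C) (fun x => a * f x).
Proof. by move=> fC x y; rewrite -mulrBr normrM -mulrA ler_wpM2l. Qed.

Lemma omega_lipschitz_shift w C f a : omega_lipschitz w C f ->
  omega_lipschitz w C (fun x => f x - a).
Proof. by move=> fC x y; rewrite opprB addrA subrK. Qed.

Lemma omega_lipschitz_clamp w C f v : omega_lipschitz w C f ->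
  omega_lipschitz w C v -> omega_lipschitz w C (fun x => clamp (f x) (v x)).
Proof. by move=> fC vC x y; apply: clamp_dist. Qed.

Lemma omega_lipschitz_cst w a : (forall t, 0 <= t -> 0 <= w t) ->
  omega_lipschitz w 0 (fun _ : X => a).
Proof. by move=> w0 x y; rewrite subrr normr0 mul0r. Qed.

End lipschitz_functions.

Section gauge.
Context (R : realType) (X : normedModType R) (w : R -> R).
Hypothesis w_ge : forall t, 0 <= t -> t <= w t.
Hypothesis w_le : forall t, 0 <= t -> w t <= t + 4 * Num.sqrt t.
Implicit Types (f g : X -> R) (C : R).

Lemma gauge_ge0 t : 0 <= t -> 0 <= w t.
Proof. by move=> t0; rewrite (le_trans t0)// w_ge. Qed.

Lemma gauge_le_affine e t : 0 < e -> 0 <= t -> w t <= e + (1 + 4 / e) * t.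
Proof.
move=> e0 t0; rewrite (le_trans (w_le t0))//.
have : 0 <= (e - 2 * Num.sqrt t) ^+ 2 / e.
  by rewrite divr_ge0 ?sqr_ge0// ltW.
rewrite sqrrB exprMn sqr_sqrtr//.
have -> : (e ^+ 2 - e * (2 * Num.sqrt t) *+ 2 + 2 ^+ 2 * t) / e =
  e - 4 * Num.sqrt t + 4 / e * t by field; rewrite gt_eqF.
lra.
Qed.

Lemma gauge_le_slope e t : 0 < e -> 0 <= t -> w t <= (1 + e) * t + 4 / e.
Proof.
move=> e0 t0; have := @gauge_le_affine (4 / e) t.
rewrite divr_gt0// => /(_ isT t0); congr (_ <= _).
by field; rewrite gt_eqF.
Qed.

Lemma lipschitz_gauge C f : 0 <= C -> omega_lipschitz id C f ->
  omega_lipschitz w C f.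
Proof. by move=> C0 fC x y; rewrite (le_trans (fC x y))// ler_wpM2l ?w_ge. Qed.

Lemma lipE C f : f 0 = 0 -> 0 <= C -> omega_lipschitz w C f ->
  exists g : lip w X, g = f :> (X -> R).
Proof.
move=> f0 C0 fC; have fP : f \in lip_pred w (X := X).
  by apply/mem_set; split=> //; exists C.
by exists (Lip fP).
Qed.

(** The infimal convolution with K |.|: the largest function below f that is
K-Lipschitz for the norm of X. *)
Definition inf_conv (K : R) f (x : X) : R := inf (range (fun v => f (x + v) + K * `|v|)).

Section inf_conv.
Variables (K e : R) (f : X -> R).
Hypothesis f1 : omega_lipschitz w 1 f.
Hypothesis e0 : 0 < e.
Hypothesis K_ge : 1 + 4 / e <= K.

Lemma inf_conv_lb x v : f x - e <= f (x + v) + K * `|v|.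
Proof.
have := f1 x (x + v); rewrite mul1r opprD addrA subrr sub0r normrN ler_norml.
move=> /andP[_]; have := @gauge_le_affine e `|v| e0 (normr_ge0 _).
have : (1 + 4 / e) * `|v| <= K * `|v| by rewrite ler_wpM2r.
lra.
Qed.

Let lbd x : has_lbound (range (fun v => f (x + v) + K * `|v|)).
Proof. by exists (f x - e) => _ [v _ <-]; exact: inf_conv_lb. Qed.

Lemma inf_conv_le x v : inf_conv K f x <= f (x + v) + K * `|v|.
Proof. by apply: (ge_inf (lbd x)); exists v. Qed.

(** A gauge lies below e + K t for K large, so the regularisation costs at most e
uniformly. *)
Lemma inf_conv_near x : f x - e <= inf_conv K f x <= f x.
Proof.
apply/andP; split; last by have := inf_conv_le x 0; rewrite addr0 normr0 mulr0 addr0.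
apply: lb_le_inf; first by exists (f (x + 0) + K * `|0 : X|), 0.
by move=> _ [v _ <-]; exact: inf_conv_lb.
Qed.

Lemma inf_conv_leD x y c : (forall v, f (y + v) <= f (x + v) + c) ->
  inf_conv K f y <= inf_conv K f x + c.
Proof.
move=> fc; rewrite -lerBlDr; apply: lb_le_inf.
  by exists (f (x + 0) + K * `|0 : X|), 0.
move=> _ [v _ <-]; have := inf_conv_le y v; have := fc v; lra.
Qed.

(** As an infimum of translates of f, the regularisation keeps the w-Lipschitz
constant. *)
Lemma inf_conv_lipschitz_gauge : omega_lipschitz w 1 (inf_conv K f).
Proof.
move=> x y; rewrite ler_distl lerBlDr mul1r.
have fv a b v : f (b + v) <= f (a + v) + w `|a - b|.
  have := f1 (b + v) (a + v); rewrite mul1r ler_distl => /andP[_].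
  by rewrite opprD addrACA subrr addr0 -normrN opprB.
apply/andP; split; apply: inf_conv_leD => v //.
by have := fv y x v; rewrite -normrN opprB.
Qed.

Lemma inf_conv_lipschitz : omega_lipschitz id K (inf_conv K f).
Proof.
have K0 : 0 <= K by rewrite (le_trans _ K_ge)// addr_ge0// divr_ge0// ltW.
have H x y : inf_conv K f y <= inf_conv K f x + K * `|x - y|.
  rewrite -lerBlDr; apply: lb_le_inf.
    by exists (f (x + 0) + K * `|0 : X|), 0.
  move=> _ [v _ <-]; have := inf_conv_le y (x - y + v).
  rewrite addrA [y + _]addrC subrK => h.
  have := ler_wpM2l K0 (ler_normD (x - y) v); lra.
move=> x y; rewrite ler_distl lerBlDr H.
by have := H y x; rewrite -normrN opprB.
Qed.

End inf_conv.
End gauge.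

(** * Free spaces as functionals on Lipschitz functions *)

Section lipfree_action.
Context (R : realType) (X : normedModType R) (w : R -> R).
Local Notation F := (lipfree w X).
Implicit Types (z : F) (f g : lip w X) (C e r K : R).

Lemma lipfree_actD z1 z2 f : (z1 + z2) f = z1 f + z2 f.
Proof. by []. Qed.

Lemma lipfree_actN z f : (- z) f = - z f.
Proof. by []. Qed.

Lemma lipfree_addr z f g : z (f + g) = z f + z g.
Proof. exact: linearD. Qed.

Lemma lipfree_oppr z f : z (- f) = - z f.
Proof. exact: linearN. Qed.

Lemma lipfree_scaler a z f : z (a *: f) = a * z f.
Proof. exact: linearZ. Qed.

Lemma lip_norm_le f C : 0 <= C -> omega_lipschitz w C f -> `|f| <= C.
Proof. by move=> C0 fC; apply: ge_inf => //; exists 0 => D []. Qed.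

Lemma lipfree_act_le z f C : 0 <= C -> omega_lipschitz w C f ->
  `|z f| <= C * `|z|.
Proof.
move=> C0 fC; rewrite (le_trans (cdual_normP _ _))// mulrC ler_wpM2r//.
exact: lip_norm_le.
Qed.

Hypothesis w_ge : forall t, 0 <= t -> t <= w t.
Hypothesis w_le : forall t, 0 <= t -> w t <= t + 4 * Num.sqrt t.

Lemma lipfree_norm_le z C :
  (forall f, omega_lipschitz w 1 f -> z f <= C) -> `|z| <= C.
Proof.
move=> zC; apply: ge_sup.
  by exists `|(z : cdual _) 0|, 0 => //=; rewrite normr0.
move=> _ [f /= f1 <-].
have fL : omega_lipschitz w 1 f.
  move=> x y; rewrite (le_trans (lip_normP f x y))// ler_wpM2r//.
  exact: gauge_ge0.
rewrite ler_norml zC// andbT.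
have := zC (- f); rewrite linearN/= => h.
by have := h (omega_lipschitzN fL); lra.
Qed.

Lemma lipfree_approx z e : 0 < e -> exists n (a : 'I_n -> R) (x : 'I_n -> X),
  `|z - \sum_(i < n) a i *: delta w (x i)| < e.
Proof.
move=> e0; have /set_mem/closureP/(_ _ e0) := lipfree_valP z.
move=> [_ [n [a [x [Ax ->]]]] zx].
have /choice[y xy] i : exists y, Defs.eval w y = x i by have [y _ <-] := Ax i; exists y.
have xE : \sum_(i < n) a i *: x i = val (\sum_(i < n) a i *: delta w (y i)).
  by rewrite raddf_sum; apply: eq_bigr => i _; rewrite -xy.
by exists n, a, y; move: zx; rewrite xE.
Qed.

Lemma lipfree_act_sum n (a : 'I_n -> R) (x : 'I_n -> X) f :
  (\sum_(i < n) a i *: delta w (x i)) f = \sum_(i < n) a i * f (x i).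
Proof. by elim/big_ind2: _ => // u r v s <- <-. Qed.

(** Up to e an element of the free space is supported by a finite set, so it is
small on functions that are small on that set. *)
Lemma lipfree_finite z e : 0 < e -> exists (E : seq X) (M : R), 0 <= M /\
  forall f C d, 0 <= C -> omega_lipschitz w C f ->
    (forall x, x \in E -> `|f x| <= d) -> `|z f| <= C * e + M * d.
Proof.
move=> e0; have [n [a [x zx]]] := lipfree_approx z e0.
exists [seq x i | i <- enum 'I_n], (\sum_(i < n) `|a i|); split.
  exact: sumr_ge0.
move=> f C d C0 fC fE; rewrite -(subrK (\sum_(i < n) a i *: delta w (x i)) z).
rewrite lipfree_actD lipfree_act_sum (le_trans (ler_normD _ _))// lerD//.
  by rewrite (le_trans (lipfree_act_le _ C0 fC))// ler_wpM2l// ltW.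
rewrite (le_trans (ler_norm_sum _ _ _))// mulr_suml ler_sum// => i _.
by rewrite normrM ler_wpM2l// fE// map_f// mem_enum.
Qed.

(** Every test function of norm 1 is the sum of a uniformly tiny function (f - f1), of
a function vanishing on a large ball (f1 - f2), and of one that is K-Lipschitz for
the norm of X with bounded support (f2), where K does not depend on f: regularise
by infimal convolution, then truncate at the tent max (0, K - |x|). *)
Lemma lip_decomposition e r : 0 < e -> 0 <= r -> exists2 K, 1 <= K & forall f,
  omega_lipschitz w 1 f -> exists f1 f2 : lip w X,
  [/\ omega_lipschitz w 1 f1, omega_lipschitz w 1 f2 & omega_lipschitz id K f2] /\
  [/\ forall x, `|f x - f1 x| <= e, forall x, `|x| <= r -> f2 x = f1 x,
      forall x, `|f2 x| <= K & forall x, K <= `|x| -> f2 x = 0].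
Proof.
move=> e0 r0; pose K := 1 + 4 / e + 3 * r + 4.
have e4 : 0 <= 4 / e by rewrite divr_ge0// ltW.
have K1 : 1 + 4 / e <= K by rewrite /K; lra.
exists K; first by rewrite /K; lra.
move=> f fL; pose g := inf_conv K f.
have gL : omega_lipschitz w 1 g by exact: (inf_conv_lipschitz_gauge w_le fL e0 K1).
have gK : omega_lipschitz id K g by apply: (inf_conv_lipschitz w_le fL e0 K1).
have gf x := inf_conv_near w_le fL e0 K1 x.
have g0L : omega_lipschitz w 1 (fun x => g x - g 0) by exact: omega_lipschitz_shift.
have [f1 f1E] : exists f1 : lip w X, f1 = (fun x => g x - g 0) :> (X -> R).
  by apply: (@lipE _ _ _ 1) => //; rewrite subrr.
pose v (x : X) := Num.max 0 (K - `|x|).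
have v0 x : 0 <= v x by rewrite /v le_max lexx.
have v1 : omega_lipschitz id 1 v.
  move=> x y; rewrite /v mul1r.
  have := ler_dist_dist x y; rewrite !ler_norml => /andP[? ?].
  by apply/andP; split; rewrite /Num.max; do ![case: ifPn => //];
    rewrite -?leNgt; lra.
have v1w : omega_lipschitz w 1 v by exact: lipschitz_gauge.
have vK : omega_lipschitz id K v.
  by apply: omega_lipschitz_le v1 => //; lra.
have f1L : omega_lipschitz w 1 f1 by rewrite f1E.
have hL : omega_lipschitz w 1 (fun x => clamp (f1 x) (v x)).
  exact: omega_lipschitz_clamp.
have [f2 f2E] : exists f2 : lip w X, f2 = (fun x => clamp (f1 x) (v x)) :> (X -> R).
  by apply: (@lipE _ _ _ 1) => //; rewrite lip0 clamp0.
exists f1, f2; rewrite f2E; split; split=> //.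
- apply: omega_lipschitz_clamp => //; rewrite f1E.
  exact: omega_lipschitz_shift.
- move=> x; rewrite f1E; have := gf x; have := gf 0; rewrite lip0 -/g.
  by move=> /andP[? ?] /andP[? ?]; rewrite ler_norml; apply/andP; split; lra.
- move=> x xr; apply: clamp_id.
  have := f1L x 0; rewrite lip0 !subr0 mul1r => /le_trans; apply.
  rewrite (le_trans (gauge_le_slope w_le ltr01 (normr_ge0 _)))// le_max.
  by apply/orP; right; rewrite /K; lra.
- move=> x; rewrite (le_trans (clamp_norm _ (v0 x)))// ge_max.
  by apply/andP; split; have := normr_ge0 x; rewrite /K; lra.
- move=> x Kx; have -> : v x = 0 by apply/max_idPl; lra.
  exact: clampv0.
Qed.

(** The regularised and truncated functions converge pointwise to f while keeping
norm 1, which suffices on the free space. *)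
Lemma lipfree_smooth_norming z f e : 0 < e -> omega_lipschitz w 1 f ->
  exists K g, [/\ 1 <= K, omega_lipschitz w 1 g & omega_lipschitz id K g] /\
    [/\ forall x, `|g x| <= K, forall x, K <= `|x| -> g x = 0 & z f - e <= z g].
Proof.
move=> e0 fL; have e4 : 0 < e / 4 by rewrite divr_gt0.
have [E [M [M0 EM]]] := lipfree_finite z e4.
have d0 : 0 < e / (2 * M + 2) by rewrite divr_gt0//; lra.
pose r := \big[Num.max/0]_(x <- E) `|x|.
have rE x : x \in E -> `|x| <= r.
  by move=> xE; rewrite /r; apply: le_bigmax_seq.
have r0 : 0 <= r by rewrite /r; elim/big_ind: _ => // s t s0 t0; rewrite le_max s0.
have [K K1 /(_ _ fL)] := lip_decomposition d0 r0.
move=> [f1 [f2 [[f1L f2L f2K] [ff1 f12 f2b f20]]]].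
exists K, f2; split; split=> //.
have := EM (f - f2) 2 (e / (2 * M + 2)).
rewrite linearB/= => h; have /ler_normlP[_] : `|z f - z f2| <= e.
  apply: (le_trans (h _ _ _)) => //.
  - exact: (omega_lipschitzB fL f2L).
  - by move=> x /rE xr; rewrite -[X in `|X|]/(f x - f2 x) f12.
  - have -> : M * (e / (2 * M + 2)) = e / 2 - e / (2 * M + 2).
      by field; apply/eqP; lra.
    by lra.
lra.
Qed.

End lipfree_action.

(** * Perturbations of test functions *)

Section perturbation.
Context (R : realType) (X : normedModType R) (w : R -> R).
Hypothesis w_ge : forall t, 0 <= t -> t <= w t.
Hypothesis w_le : forall t, 0 <= t -> w t <= t + 4 * Num.sqrt t.
Implicit Types (f g q v : X -> R) (A C K s t : R) (E : seq X).

Lemma gauge0 : w 0 = 0.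
Proof.
apply/eqP; rewrite eq_le w_ge// andbT.
by rewrite (le_trans (w_le _))// sqrtr0 mulr0 addr0.
Qed.

Lemma omega_lipschitz_disjoint C f g : omega_lipschitz w C f ->
  omega_lipschitz w C g ->
  (forall x y, f x != 0 -> g y != 0 -> `|f x| + `|g y| <= C * w `|x - y|) ->
  omega_lipschitz w C (f \+ g).
Proof.
move=> fC gC fg.
have fg0 x : f x = 0 \/ g x = 0.
  have [->|fx] := eqVneq (f x) 0; first by left.
  have [->|gx] := eqVneq (g x) 0; first by right.
  have := fg x x fx gx; rewrite subrr normr0 gauge0 mulr0.
  have : 0 < `|f x| by rewrite normr_gt0.
  by have := normr_ge0 (g x); lra.
have cross x y : f y = 0 -> g x = 0 -> `|f x - g y| <= C * w `|x - y| /\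
    `|f x + g y| <= C * w `|x - y|.
  move=> fy gx; have [fx|fx] := eqVneq (f x) 0.
    by have := gC x y; rewrite fx gx sub0r add0r normrN.
  have [gy|gy] := eqVneq (g y) 0.
    by have := fC x y; rewrite fy gy subr0 addr0.
  by split; rewrite (le_trans _ (fg _ _ fx gy))// ?ler_normD// ler_normB.
move=> x y /=.
case: (fg0 x) (fg0 y) => [fx|gx] [fy|gy].
- by rewrite fx fy !add0r.
- rewrite fx gy add0r addr0 distrC -normrN [`|x - y|]distrC normrN.
  by have [] := cross y x fx gy.
- rewrite fy gx add0r addr0.
  by have [] := cross x y fy gx.
- by rewrite gx gy !addr0.
Qed.

(** The bound by C s / 2 takes over from the D-Lipschitz bound beyond distance s. *)
Lemma omega_lipschitz_min C D s f : 0 < s -> 0 <= C ->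
  (forall t, 0 <= t -> t <= s -> D * t <= C * w t) ->
  omega_lipschitz id D f -> (forall x, `|f x| <= C * s / 2) ->
  omega_lipschitz w C f.
Proof.
move=> s0 C0 Ds fD fs x y; have [xs|xs] := leP `|x - y| s.
  by rewrite (le_trans (fD x y))// Ds.
rewrite (le_trans (ler_normB _ _))//.
have := w_ge (normr_ge0 (x - y)).
by have := fs x; have := fs y; nra.
Qed.

(** At distances up to s the increments of g are negligible against w, beyond s
those of f are. *)
Lemma fine_perturbation K s t f g : 0 < s -> 0 <= t ->
  (forall d, 0 <= d -> d <= s -> K * d <= t * w d) ->
  omega_lipschitz w 1 g -> omega_lipschitz id K g -> omega_lipschitz w 1 f ->
  (forall x, `|f x| <= t * s / 2) -> omega_lipschitz w (1 + t) (g \+ f).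
Proof.
move=> s0 t0 Ks g1 gK f1 fs x y /=; rewrite opprD addrACA.
rewrite (le_trans (ler_normD _ _))//.
have w0 : 0 <= w `|x - y| by apply: gauge_ge0.
have [xs|xs] := leP `|x - y| s.
  by have := f1 x y; have := gK x y; have := Ks _ (normr_ge0 (x - y)) xs; lra.
have := ler_normB (f x) (f y); have := fs x; have := fs y; have := g1 x y.
by have := w_ge (normr_ge0 (x - y)); nra.
Qed.

(** A point where g lives and a point where f lives are so far apart that
w, which is nearly the identity at large scale, absorbs both values. *)
Lemma far_perturbation K r t f g : 0 < t -> 0 < K -> 2 * K + 4 / t <= r ->
  omega_lipschitz w 1 g -> (forall x, `|g x| <= K) ->
  (forall x, K <= `|x| -> g x = 0) ->
  omega_lipschitz w 1 f -> (forall x, `|x| <= r -> f x = 0) ->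
  omega_lipschitz w (1 + t) (g \+ f).
Proof.
move=> t0 K0 rK g1 gK g0 f1 f0.
have r4 : 0 < 4 / t by rewrite divr_gt0.
have w0 := gauge_ge0 w_ge.
apply: omega_lipschitz_disjoint.
- by apply: omega_lipschitz_le g1 => //; lra.
- by apply: omega_lipschitz_le f1 => //; lra.
move=> x y gx fy.
have xK : `|x| < K by rewrite ltNge; apply: contra gx => /g0 ->.
have yr : r < `|y| by rewrite ltNge; apply: contra fy => /f0 ->.
have ny0 : 0 < `|y| by lra.
pose y' := (r / `|y|) *: y.
have y'r : `|y'| = r by rewrite normrZ normrM normfV normr_id gtr0_norm ?divfK//; lra.
have yy' : `|y - y'| = `|y| - r.
  have -> : y - y' = (1 - r / `|y|) *: y by rewrite scalerBl scale1r.
  rewrite normrZ ger0_norm; last by rewrite subr_ge0 ler_pdivrMr// mul1r ltW.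
  by rewrite mulrBl mul1r divfK// gt_eqF.
have fyb : `|f y| <= (1 + t) * (`|y| - r) + 4 / t.
  have := f1 y y'; rewrite (f0 y') ?y'r// subr0 mul1r yy' => /le_trans; apply.
  by apply: gauge_le_slope => //; lra.
have := gK x; have := w_ge (normr_ge0 (x - y)).
have := lerB_dist y x; rewrite distrC.
nra.
Qed.

(** After q is cut off by v, points where the two functions do not vanish are at
distance at least d, and the cap 1 + 1 on the increments is below A d. *)
Lemma tight_perturbation E d A f q v : 0 < d -> 0 <= A -> 2 <= A * d ->
  omega_lipschitz w A f -> (forall x, `|f x| <= 1) ->
  omega_lipschitz w A q -> (forall x, `|q x| <= 1) ->
  omega_lipschitz w A v ->
  (forall x, 0 <= v x) ->
  (forall x, v x != 0 -> exists2 e, e \in E & `|x - e| < d) ->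
  (forall x e, e \in E -> `|x - e| < 2 * d -> f x = 0) ->
  let q1 x := clamp (q x) (v x) in
  omega_lipschitz w A (q1 \+ f) /\ (forall x, `|q1 x + f x| <= 1).
Proof.
move=> d0 A0 Ad fA f1 qA qb vA v0 vE fE q1.
have q1E x : q1 x != 0 -> exists2 e, e \in E & `|x - e| < d.
  by move=> qx; apply: vE; apply: contra qx => /eqP vx; rewrite /q1 vx clampv0.
have q1b x : `|q1 x| <= 1.
  by rewrite (le_trans _ (qb x))// clamp_le.
split.
  apply: omega_lipschitz_disjoint => //; first exact: omega_lipschitz_clamp.
  move=> x y /q1E[e eE xe] fy.
  have xy : d <= `|x - y|.
    rewrite leNgt; apply: contra fy => xy; apply/eqP/(fE _ _ eE).
    have -> : y - e = (y - x) + (x - e) by rewrite addrA subrK.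
    by rewrite (le_lt_trans (ler_normD _ _))// [`|y - x|]distrC; lra.
  have := q1b x; have := f1 y; have := w_ge (normr_ge0 (x - y)); nra.
move=> x; have [->|/q1E[e eE xe]] := eqVneq (q1 x) 0; first by rewrite add0r.
by rewrite (fE x e)// ?addr0//; lra.
Qed.

Lemma bump_function E d : 0 < d -> exists v : X -> R,
  [/\ omega_lipschitz id d^-1 v, forall x, 0 <= v x,
      forall x, x \in E -> 1 <= v x &
      forall x, v x != 0 -> exists2 e, e \in E & `|x - e| < d].
Proof.
move=> d0; elim: E => [|e E [v [vL v0 v1 vE]]].
  exists (fun=> 0); split=> // [x y|x]; last by rewrite eqxx.
  by rewrite subrr normr0 mulr_ge0// invr_ge0 ltW.
exists (fun x => Num.max (v x) (1 - d^-1 * `|x - e|)); split.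
- move=> x y; have := vL x y; rewrite !ler_distl => /andP[? ?].
  have : `|(`|x - e| - `|y - e|)| <= `|x - y|.
    by rewrite (le_trans (ler_dist_dist _ _))// opprB addrA subrK.
  rewrite ler_norml => /andP[h1 h2].
  have d'0 : 0 <= d^-1 by rewrite invr_ge0 ltW.
  have := ler_wpM2l d'0 h1; have := ler_wpM2l d'0 h2.
  rewrite mulrN !mulrBr => ? ?.
  by apply/andP; split; rewrite /Num.max; do ![case: ifPn => //];
    rewrite -?leNgt; lra.
- by move=> x; rewrite le_max v0.
- move=> x; rewrite inE le_max => /orP[/eqP->|/v1->//].
  by rewrite subrr normr0 mulr0 subr0 lexx orbT.
- move=> x; have [vx|vx] := eqVneq (v x) 0; last first.
    by have [e' e'E ?] := vE _ vx; exists e' => //; rewrite inE e'E orbT.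
  rewrite vx => xe; exists e; first by rewrite inE eqxx.
  move: xe; apply: contraNT; rewrite -leNgt => dx; apply/eqP/max_idPl.
  by rewrite subr_le0 mulrC ler_pdivlMr// mul1r.
Qed.

End perturbation.

(** * Finite-dimensional pigeonhole and midpoints in c_0 *)

Section pigeonhole.
Context (R : realType).

Lemma quantization (M e : R) : 0 < e -> exists (P : nat) (c : R -> 'I_P.+1),
  forall a b, `|a| <= M -> `|b| <= M -> c a = c b -> `|a - b| <= e.
Proof.
move=> e0; exists (Num.truncn (2 * M / e)), (fun a => inord (Num.truncn ((a + M) / e))).
have cE a : `|a| <= M -> (Num.truncn ((a + M) / e) < (Num.truncn (2 * M / e)).+1)%N.
  rewrite ler_norml => /andP[? ?]; rewrite ltnS le_truncn// ler_pM2r ?invr_gt0//; lra.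
have cI a : `|a| <= M ->
    (Num.truncn ((a + M) / e))%:R <= (a + M) / e < (Num.truncn ((a + M) / e)).+1%:R.
  by rewrite ler_norml => /andP[? ?]; apply: truncn_itv; rewrite divr_ge0 ?(ltW e0)//; lra.
move=> a b aM bM /(congr1 val); rewrite /= !inordK ?cE// => ab.
have := cI a aM; have := cI b bM; rewrite ab => /andP[b1 b2] /andP[a1 a2].
have -> : a - b = ((a + M) / e - (b + M) / e) * e by field; rewrite gt_eqF.
rewrite normrM (gtr0_norm e0) -[leRHS]mul1r ler_wpM2r ?(ltW e0)//.
rewrite ler_norml; move: a1 a2 b1 b2; rewrite -natr1 => *.
by apply/andP; split; lra.
Qed.

Lemma bounded_pigeonhole (I : finType) (M e : R) (u : nat -> I -> R) :
  0 < e -> (forall n i, `|u n i| <= M) ->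
  exists n m, n != m /\ forall i, `|u n i - u m i| <= e.
Proof.
move=> e0 uM; have [P [c cP]] := quantization M e0.
pose code n := [ffun i => c (u n i)].
pose N := #|{ffun I -> 'I_P.+1}|.
have /injectivePn[n [m nm /ffunP cnm]] :
    ~~ injectiveb (fun k : 'I_N.+1 => code k).
  apply/injectiveP => /leq_card; by rewrite card_ord ltnn.
exists (n : nat), (m : nat); split=> // i; apply: cP => //.
by have := cnm i; rewrite !ffunE.
Qed.

Lemma finite_net (T X : Type) (ev : T -> X -> R) (S : set T) (M e : R)
    (N : nat) (x : 'I_N -> X) : 0 < e -> S !=set0 ->
  (forall t i, S t -> `|ev t (x i)| <= M) ->
  exists (I : finType) (rep : I -> T), (forall i, S (rep i)) /\
    forall t, S t -> exists i, forall j, `|ev t (x j) - ev (rep i) (x j)| <= e.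
Proof.
move=> e0 [t0 St0] SM; have [P [c cP]] := quantization M e0.
pose code t := [ffun j => c (ev t (x j))].
have /choice[rep repP] (i : {ffun 'I_N -> 'I_P.+1}) :
    exists t, S t /\ ((exists2 t', S t' & code t' = i) -> code t = i).
  have [[t St ti]|ni] := pselect (exists2 t', S t' & code t' = i).
    by exists t.
  by exists t0.
exists {ffun 'I_N -> 'I_P.+1}, rep; split=> [i|t St]; first by have [] := repP i.
exists (code t) => j; have [Sr] := repP (code t).
move=> /(_ (ex_intro2 _ _ t St erefl)) /ffunP/(_ j); rewrite !ffunE => cj.
by apply: cP; [exact: SM|exact: SM|].
Qed.

(** Functions with values in a bounded interval on a finite set E form a totally
bounded family there; a bounded sequence of functionals on it has two terms
that nearly agree on a finite net. *)
Lemma totally_bounded_pigeonhole (T : Type) (X : eqType) (ev : T -> X -> R)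
    (S : set T) (E : seq X) (M M' e e' : R) (u : nat -> T -> R) :
  0 < e -> 0 < e' -> S !=set0 ->
  (forall t x, S t -> `|ev t x| <= M) ->
  (forall n t, S t -> `|u n t| <= M') ->
  exists n m, n != m /\ forall t, S t -> exists t', [/\ S t',
    forall x, x \in E -> `|ev t x - ev t' x| <= e & `|u n t' - u m t'| <= e'].
Proof.
move=> e0 e'0 S0 SM uM.
have [I [rep [Srep repP]]] := @finite_net _ _ ev S M e _ (tnth (in_tuple E)) e0 S0
  (fun t i St => SM t _ St).
have [n [m [nm unm]]] := @bounded_pigeonhole I M' e' (fun n i => u n (rep i)) e'0
  (fun n i => uM n _ (Srep i)).
exists n, m; split=> // t /repP[i ri]; exists (rep i); split=> // x.
by move=> /(tnthP (in_tuple E))[j ->].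
Qed.

End pigeonhole.

Section c0_geometry.
Context (R : realType).
Local Notation c0 := (c0 R).

Lemma c0_ext (u v : c0) : (forall n, u n = v n) -> u = v.
Proof. by move=> uv; apply: val_inj; apply/funext. Qed.

Lemma c0_coordD (u v : c0) n : (u + v) n = u n + v n. Proof. by []. Qed.
Lemma c0_coordN (u : c0) n : (- u) n = - u n. Proof. by []. Qed.
Lemma c0_coordZ a (u : c0) n : (a *: u) n = a * u n. Proof. by []. Qed.
Definition c0_coordE := (c0_coordD, c0_coordN, c0_coordZ).

Lemma c0_coord_le (u : c0) n : `|u n| <= `|u|.
Proof. by have := c0_norm_ub u n; rewrite mulr1. Qed.

Lemma c0_norm_le (u : c0) C : (forall n, `|u n| <= C) -> `|u| <= C.
Proof.
move=> uC; apply: ge_sup; first by exists `|u 0%N|, 0%N.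
by move=> _ [n _ <-].
Qed.

Lemma c0_basis n : exists e : c0, forall k, e k = (k == n)%:R.
Proof.
have eP : (fun k => (k == n)%:R) \in @c0_pred R.
  apply/mem_set => /=; apply: cvg_near_cst; exists n.+1 => // k /= nk.
  by rewrite gtn_eqF.
by exists (C0 eP).
Qed.

(** The coordinates of (x - y) / 2 tend to 0, so adding (|x - y| / 2) e_n for n large
barely increases its norm. *)
Lemma c0_midpoints (x y : c0) t : 0 < t -> x != y ->
  exists u : nat -> c0, [/\ forall n, `|x - u n| <= (1 + t) * (`|x - y| / 2),
    forall n, `|u n - y| <= (1 + t) * (`|x - y| / 2) &
    forall n m, n != m -> `|x - y| / 2 <= `|u n - u m|].
Proof.
move=> t0 xy; pose r := `|x - y| / 2.
have r0 : 0 < r by rewrite divr_gt0// normr_gt0 subr_eq0.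
pose d := 2^-1 *: (x - y).
have dr k : `|d k| <= r.
  rewrite (le_trans (c0_coord_le d k))// normrZ mulrC ler_wpM2l//.
  by rewrite ger0_norm// invr_ge0.
have [N _ dN] : \forall n \near \oo, `|d n| < t * r.
  by have /cvgr0Pnorm_lt := @c0_cvg R d; apply; rewrite mulr_gt0.
have /choice[e eE] := c0_basis.
have mid n (s : R) : `|s| = 1 -> `|s *: d + r *: e (N + n)%N| <= (1 + t) * r.
  move=> s1; apply: c0_norm_le => k.
  rewrite -[X in `|X|]/(s * d k + r * e (N + n)%N k) eE.
  rewrite (le_trans (ler_normD _ _))// [`|s * _|]normrM s1 mul1r.
  have [->|_] := eqVneq k (N + n)%N.
    have := dN (N + n)%N (leq_addr _ _); rewrite mulr1 (gtr0_norm r0); lra.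
  rewrite mulr0 normr0 addr0; have := dr k; have : 0 < t * r by rewrite mulr_gt0.
  lra.
pose u n := 2^-1 *: (x + y) + r *: e (N + n)%N.
exists u; split.
- move=> n; rewrite distrC; have := mid n (-1); rewrite normrN normr1 => /(_ erefl).
  congr (`|_| <= _); apply: c0_ext => k.
  by rewrite /u /d !c0_coordE; field.
- move=> n; have := mid n 1; rewrite normr1 => /(_ erefl).
  congr (`|_| <= _); apply: c0_ext => k.
  by rewrite /u /d !c0_coordE; field.
- move=> n m nm.
  have -> : u n - u m = r *: (e (N + n)%N - e (N + m)%N).
    by rewrite /u opprD addrACA subrr add0r scalerBr.
  have := c0_coord_le (r *: (e (N + n)%N - e (N + m)%N)) (N + n)%N.
  rewrite !c0_coordE.
  by rewrite !eE eqxx eqn_add2l (negPf nm) subr0 mulr1 gtr0_norm.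
Qed.

End c0_geometry.

(** * Midpoints under a Lipschitz map from c_0 *)

Section no_embedding.
Context (R : realType) (X : normedModType R) (w : R -> R).
Hypothesis w_ge : forall t, 0 <= t -> t <= w t.
Hypothesis w_le : forall t, 0 <= t -> w t <= t + 4 * Num.sqrt t.
Local Notation F := (lipfree w X).
Local Notation c0 := (c0 R).
Implicit Types (b f g q : lip w X) (W : set (lip w X)) (x y : c0).
Implicit Types (A B C S K L k d s t z : R).
Variables (h : c0 -> F) (H : R).
Hypothesis hH : forall x y, `|h x - h y| <= H * `|x - y|.

Definition slopes W : set R := [set s | exists x y g,
  [/\ x != y, W g & s = (h x - h y) g / `|x - y|]].

Lemma slopes_sup W C : 0 <= C -> W !=set0 ->
  (forall g, W g -> omega_lipschitz w C g) ->
  exists L : R, [/\ 0 <= L, forall x y g, W g -> (h x - h y) g <= L * `|x - y| &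
    forall t, 0 < t -> exists x y g,
      [/\ x != y, W g & (L - t) * `|x - y| <= (h x - h y) g]].
Proof.
move=> C0 [g0 Wg0] WC.
have [e eE] := c0_basis R 0.
have e0 : e != 0.
  apply/eqP => e0; have := eE 0%N; rewrite e0 eqxx => /eqP.
  by rewrite eq_sym oner_eq0.
have has_supW : has_sup (slopes W).
  split; first by exists ((h e - h 0) g0 / `|e - 0|), e, 0, g0.
  exists (C * H) => _ [x [y [g [xy Wg ->]]]].
  rewrite ler_pdivrMr ?normr_gt0 ?subr_eq0//.
  have := lipfree_act_le (h x - h y) C0 (WC _ Wg).
  have := hH x y; have := ler_norm ((h x - h y) g); nra.
have Lub x y g : W g -> (h x - h y) g <= sup (slopes W) * `|x - y|.
  move=> Wg; have [->|xy] := eqVneq x y.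
    by rewrite !subrr normr0 mulr0.
  rewrite -ler_pdivrMr ?normr_gt0 ?subr_eq0//.
  by apply: (ub_le_sup has_supW.2); exists x, y, g.
exists (sup (slopes W)); split=> //.
  have := Lub e 0 g0 Wg0; have := Lub 0 e g0 Wg0.
  rewrite -(opprB (h e)) lipfree_actN [`|0 - e|]distrC.
  have : 0 < `|e - 0| by rewrite normr_gt0 subr_eq0.
  nra.
move=> t t0; have [_ [x [y [g [xy Wg ->]]]] lt] := sup_adherent t0 has_supW.
exists x, y, g; split=> //.
by rewrite -ler_pdivlMr ?normr_gt0 ?subr_eq0// ltW.
Qed.

Lemma lipfree_sandwich (z1 z2 : F) g g' f S1 S2 : z1 (g + f) <= S1 ->
  z2 (g' - f) <= S2 -> (z1 - z2) f <= S1 + S2 - (z1 g + z2 g').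
Proof.
rewrite lipfree_actD lipfree_actN !lipfree_addr lipfree_oppr; lra.
Qed.

(** If both z1 and z2 have norm at most B and (z1 + z2) g is almost 2 B, then z1 - z2
almost vanishes on each f for which g + f and g - f still have norm almost 1:
this is how extremality constrains midpoints. *)
Lemma lipfree_sandwich_norm (z1 z2 : F) g f B S : 0 <= S -> `|z1| <= B -> `|z2| <= B ->
  omega_lipschitz w S (g + f) -> omega_lipschitz w S (g - f) ->
  `|(z1 - z2) f| <= 2 * (S * B) - (z1 + z2) g.
Proof.
move=> S0 z1B z2B gfS gfS'.
have bd (z : F) (k : lip w X) : `|z| <= B -> omega_lipschitz w S k -> z k <= S * B.
  move=> zB kS; rewrite (le_trans (ler_norm _))//.
  by rewrite (le_trans (lipfree_act_le _ S0 kS))// ler_wpM2l.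
rewrite ler_norml; have := lipfree_sandwich (bd _ _ z1B gfS) (bd _ _ z2B gfS').
have gfN : omega_lipschitz w S (g - - f) by rewrite opprK.
have := lipfree_sandwich (bd _ _ z1B gfS') (bd _ _ z2B gfN).
rewrite lipfree_oppr -!(lipfree_actD z1 z2 g) => ? ?; apply/andP; split; lra.
Qed.

(** Test functions of the bounded seminorm that detects escape from finite sets. *)
Definition capped A : set (lip w X) :=
  [set q | omega_lipschitz w A q /\ forall v, `|q v| <= 1].

(** Extremality of the slope under g + k q, applied with q replaced by q' + b and
by q' - b, where q' is cut off away from a finite set E nearly carrying h x - h y
and agrees with q on E. *)
Lemma tightness G A k d L t x y g q : 0 < A -> 0 < k -> 0 < d -> 2 <= A * d ->
  0 <= L -> 0 < t -> x != y ->
  (forall x y g q, G g -> capped A q -> (h x - h y) (g + k *: q) <= L * `|x - y|) ->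
  G g -> capped A q -> (L - t) * `|x - y| <= (h x - h y) (g + k *: q) ->
  exists E : seq X, forall u b, `|x - u| <= (1 + t) * (`|x - y| / 2) ->
    `|u - y| <= (1 + t) * (`|x - y| / 2) -> capped A b ->
    (forall v e, e \in E -> `|v - e| < 2 * d -> b v = 0) ->
    (h x - h u - (h u - h y)) b <= (2 + L) * t / k * `|x - y|.
Proof.
move=> A0 k0 d0 Ad L0 t0 xy hub Gg [qA q1] near.
have r0 : 0 < `|x - y| by rewrite normr_gt0 subr_eq0.
have e0 : 0 < t * `|x - y| / (2 * A * k) by rewrite divr_gt0 ?mulr_gt0.
have [E [M [M0 EM]]] := lipfree_finite (h x - h y) e0.
exists E => u b xu uy [bA b1] bE.
have [v [vL v0 v1 vE]] := bump_function E d0.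
have dA : d^-1 <= A by rewrite -div1r ler_pdivrMr//; lra.
have vA : omega_lipschitz w A v.
  apply: lipschitz_gauge => //; first exact: ltW.
  by apply: omega_lipschitz_le vL.
pose q1f a := clamp (q a) (v a).
have q1fA : omega_lipschitz w A q1f by exact: omega_lipschitz_clamp.
have [q' q'E] : exists q' : lip w X, q' = q1f :> (X -> R).
  by apply: (@lipE _ _ _ A) => //; [rewrite /q1f lip0 clamp0|exact: ltW].
have q'A : omega_lipschitz w A q' by rewrite q'E.
have Qplus (b' : lip w X) : omega_lipschitz w A b' -> (forall v, `|b' v| <= 1) ->
    (forall v e, e \in E -> `|v - e| < 2 * d -> b' v = 0) -> capped A (q' + b').
  move=> b'A b'1 b'E.
  have [h1 h2] : omega_lipschitz w A (q1f \+ b') /\ (forall v, `|q1f v + b' v| <= 1).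
    exact: (tight_perturbation w_ge w_le d0 (ltW A0) Ad b'A b'1 qA q1 vA v0 vE b'E).
  by rewrite -q'E in h1 h2; split.
have Q1 := Qplus b bA b1 bE.
have Q2 : capped A (q' - b).
  apply: Qplus => [|z|z e eE ze]; first exact: omega_lipschitzN.
    by rewrite -[X in `|X|]/(- b z) normrN.
  by rewrite -[LHS]/(- b z) (bE z e)// oppr0.
have := lipfree_sandwich (f := k *: b) (g := g + k *: q') (g' := g + k *: q')
  (z1 := h x - h u) (z2 := h u - h y).
rewrite -addrA -[_ + _ - _]addrA -scalerBr -scalerDr.
move=> /(_ _ _ (hub _ _ _ _ Gg Q1) (hub _ _ _ _ Gg Q2)).
rewrite -lipfree_actD addrA subrK lipfree_scaler => bound.
have qq' : (h x - h y) q - (h x - h y) q' <= t * `|x - y| / k.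
  have := EM (q - q') (A + A) 0 (addr_ge0 (ltW A0) (ltW A0)).
  rewrite lipfree_addr lipfree_oppr mulr0 addr0 => hE.
  apply: (le_trans (ler_norm _)); apply: (le_trans (hE _ _)).
  - exact: (omega_lipschitzB qA q'A).
  - move=> e eE; rewrite -[X in `|X|]/(q e - q' e) q'E /q1f clamp_id ?subrr ?normr0//.
    by rewrite (le_trans (q1 e))// v1.
  - suff -> : (A + A) * (t * `|x - y| / (2 * A * k)) = t * `|x - y| / k by [].
    by field; rewrite !gt_eqF.
move: near bound; rewrite !lipfree_addr !lipfree_scaler => near bound.
have : k * ((h x - h y) q - (h x - h y) q') <= t * `|x - y|.
  by rewrite mulrC -ler_pdivlMr.
have -> : (2 + L) * t / k * `|x - y| = (2 + L) * t * `|x - y| / k by ring.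
rewrite ler_pdivlMr//.
have : L * `|x - u| <= L * ((1 + t) * (`|x - y| / 2)) by rewrite ler_wpM2l.
have : L * `|u - y| <= L * ((1 + t) * (`|x - y| / 2)) by rewrite ler_wpM2l.
lra.
Qed.

(** The truncation a of f - f' at level t s / 2 has w-Lipschitz norm at most t because
w is steep; the remainder b vanishes near E, where D is controlled. *)
Lemma lipfree_act_close (D : F) (E : seq X) A K d s t z e (f f' : lip w X) :
  1 <= A -> 1 <= K -> 0 < d -> 0 < s -> 0 <= t ->
  (forall r, 0 <= r -> r <= s -> 2 * K * r <= t * w r) ->
  e + 4 * K * d <= t * s / 2 -> 0 <= e ->
  (forall b, capped A b -> (forall v e, e \in E -> `|v - e| < 2 * d -> b v = 0) ->
    D b <= z) ->
  omega_lipschitz w 1 f -> omega_lipschitz w 1 f' ->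
  omega_lipschitz id K f -> omega_lipschitz id K f' ->
  (forall v, `|f v| <= K) -> (forall v, `|f' v| <= K) ->
  (forall v, v \in E -> `|f v - f' v| <= e) ->
  D (f - f') <= 4 * K * z + t * `|D|.
Proof.
move=> A1 K1 d0 s0 t0 ts es e0 Dz f1 f'1 fK f'K fb f'b ff'.
have dL := omega_lipschitzB f1 f'1.
have dK := omega_lipschitzB fK f'K.
have db (x : X) : `|f x - f' x| <= 2 * K.
  by rewrite (le_trans (ler_normB _ _))//; have := fb x; have := f'b x; lra.
pose m := t * s / 2.
have m0 : 0 <= m by rewrite divr_ge0// mulr_ge0// ltW.
have w0 := gauge_ge0 w_ge.
pose af (x : X) := clamp (f x - f' x) m.
have af2 : omega_lipschitz w (1 + 1) af.
  apply: (omega_lipschitz_clamp dL).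
  by apply: (@omega_lipschitz_le _ _ w 0) => //; exact: omega_lipschitz_cst.
have afK : omega_lipschitz id (K + K) af.
  apply: (omega_lipschitz_clamp dK).
  by apply: (@omega_lipschitz_le _ _ id 0) => //; [lra|exact: omega_lipschitz_cst].
have [a aE] : exists a : lip w X, a = af :> (X -> R).
  apply: (@lipE _ _ _ (1 + 1)) => //.
  by rewrite /af !lip0 subrr clamp0.
have at_ : omega_lipschitz w t a.
  rewrite aE; apply: (omega_lipschitz_min w_ge s0 t0 _ afK).
    by move=> r r0 rs; have := ts r r0 rs; lra.
  by move=> x; exact: clamp_norm.
have a2 : omega_lipschitz w (1 + 1) a by rewrite aE.
pose b := f - f' - a.
have bE (x : X) : b x = f x - f' x - clamp (f x - f' x) m.
  by rewrite -[LHS]/(f x - f' x - a x) aE.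
have b4 : omega_lipschitz w (1 + 1 + (1 + 1)) b.
  exact: (omega_lipschitzB dL a2).
have bb (x : X) : `|b x| <= 2 * K.
  by rewrite bE (le_trans _ (db x))// clamp_sub_le.
have K40 : 0 < 4 * K by lra.
have -> : f - f' = 4 * K *: ((4 * K)^-1 *: b) + a.
  by rewrite scalerA divff ?gt_eqF// scale1r /b subrK.
rewrite lipfree_addr lipfree_scaler lerD//; last first.
  by rewrite (le_trans (ler_norm _))// lipfree_act_le.
rewrite ler_wpM2l//; first lra.
have K41 : (4 * K)^-1 <= 4^-1 by rewrite lef_pV2 ?posrE; lra.
apply: Dz; first split.
- apply: omega_lipschitz_le (omega_lipschitzZ (4 * K)^-1 b4) => //.
  by rewrite ger0_norm ?invr_ge0; lra.
- move=> x; rewrite -[X in `|X|]/((4 * K)^-1 * b x) normrM ger0_norm ?invr_ge0; last lra.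
  by rewrite mulrC ler_pdivrMr//; have := bb x; lra.
- move=> v u uE vu; rewrite -[LHS]/((4 * K)^-1 * b v) bE clamp_id ?subrr ?mulr0//.
  have -> : f v - f' v = (f u - f' u) + (f v - f u) - (f' v - f' u) by ring.
  rewrite (le_trans (ler_normB _ _))// (le_trans (lerD (ler_normD _ _) (lexx _)))//.
  have := ff' u uE; have := fK v u; have := f'K v u.
  have /(ler_wpM2l (le_trans ler01 K1)) := ltW vu => /=; rewrite /m; lra.
Qed.

End no_embedding.

(** Nearly maximise the slopes of h over the functions g + k q. The penalty is
so small that g alone still has slope almost L, and the precision t of the
maximisation is then chosen small with respect to k and z. *)
Lemma penalised_maximal_pair (R : realType) (X : normedModType R) (w : R -> R)
    (h : c0 R -> lipfree w X) (G : set (lip w X)) (L A d e m z : R) :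
  gauge w -> 0 <= L -> (forall x y, `|h x - h y| <= L * `|x - y|) ->
  (forall g, G g -> omega_lipschitz w 1 g) ->
  (exists x y (g : lip w X), [/\ x != y, G g & (L - e) * `|x - y| <= (h x - h y) g]) ->
  0 < A -> 0 < d -> 2 <= A * d -> 0 < e -> 0 < m -> 0 < z ->
  exists x y (g : lip w X) (t : R) (E : seq X), [/\ x != y, G g, 0 < t <= m,
    (L - 3 * e) * `|x - y| <= (h x - h y) g &
    forall u (b : lip w X), `|x - u| <= (1 + t) * (`|x - y| / 2) ->
      `|u - y| <= (1 + t) * (`|x - y| / 2) -> capped A b ->
      (forall v c, c \in E -> `|v - c| < 2 * d -> b v = 0) ->
      (h x - h u - (h u - h y)) b <= z * `|x - y|].
Proof.
move=> [w_ge w_le] L0 hL G1 [x0 [y0 [g0 [xy0 Gg0 g0n]]]] A0 d0 Ad e0 m0 z0.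
have w0 := gauge_ge0 w_ge.
have Q0 : capped A (0 : lip w X).
  split=> [|v]; last by rewrite -[X in `|X|]/(0 : R) normr0.
  apply: (@omega_lipschitz_le _ _ w 0) => //; first exact: ltW.
  exact: (omega_lipschitz_cst 0 w0).
have [k [k0 kAL]] : exists k : R, 0 < k /\ k * (A * L) <= e.
  have AL : 0 < A * (L + 1) by rewrite mulr_gt0// ltr_wpDl.
  exists (e / (A * (L + 1))); split; first exact: divr_gt0.
  by rewrite mulrAC ler_pdivrMr// ler_wpM2l ?ler_wpM2l ?lerDl// ltW.
pose G2 : set (lip w X) := [set f | exists g q, [/\ G g, capped A q & f = g + k *: q]].
have [M [M0 hM nearM]] : exists M : R, [/\ 0 <= M,
    forall x y g, G2 g -> (h x - h y) g <= M * `|x - y| &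
    forall t, 0 < t -> exists x y g,
      [/\ x != y, G2 g & (M - t) * `|x - y| <= (h x - h y) g]].
  apply: (@slopes_sup _ _ _ _ _ hL _ (1 + `|k| * A)).
  - by rewrite addr_ge0// mulr_ge0// ltW.
  - by exists (g0 + k *: 0), g0, 0.
  - move=> _ [g [q [/G1 g1 [qA _] ->]]].
    exact: (omega_lipschitzD g1 (omega_lipschitzZ k qA)).
have LM : L - e <= M.
  have r0 : 0 < `|x0 - y0| by rewrite normr_gt0 subr_eq0.
  rewrite -(ler_pM2r r0) (le_trans g0n)//.
  by apply: hM; exists g0, 0; split=> //; rewrite scaler0 addr0.
have M2 : 0 < 2 + M by lra.
pose t := Num.min m (Num.min e (z * k / (2 + M))).
have t0 : 0 < t by rewrite !lt_min m0 e0 divr_gt0// mulr_gt0.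
have tm : t <= m by rewrite ge_min lexx.
have te : t <= e by rewrite !ge_min lexx orbT.
have tz : (2 + M) * t / k <= z.
  rewrite ler_pdivrMr// mulrC -ler_pdivlMr// /t !ge_min lexx !orbT//.
have [x [y [_ [xy [g [q [Gg Qq ->]]] near]]]] := nearM t t0.
have hub y1 y2 f p : G f -> capped A p ->
    (h y1 - h y2) (f + k *: p) <= M * `|y1 - y2|.
  by move=> Gf Qp; apply: hM; exists f, p.
have [E tight] := tightness w_ge w_le A0 k0 d0 Ad M0 t0 xy hub Gg Qq near.
exists x, y, g, t, E; split=> //; first by rewrite t0.
  have hq : k * (h x - h y) q <= e * `|x - y|.
    have [qA _] := Qq.
    have := le_trans (ler_norm _) (lipfree_act_le (h x - h y) (ltW A0) qA).
    move=> /le_trans/(_ (ler_wpM2l (ltW A0) (hL x y)))/(ler_wpM2l (ltW k0)) kq.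
    apply: (le_trans kq); rewrite !mulrA ler_wpM2r//.
    by rewrite -mulrA.
  have Mt : (L - e - e) * `|x - y| <= (M - t) * `|x - y|.
    by rewrite ler_wpM2r// lerB.
  move: near; rewrite lipfree_addr lipfree_scaler => near.
  by move: Mt hq near; clear; lra.
move=> u b xu uy Qb bE; apply: (le_trans (tight u b xu uy Qb bE)).
by rewrite ler_wpM2r.
Qed.

Lemma perturbation_defect (R : realType) (X : normedModType R) (w : R -> R)
    (h : c0 R -> lipfree w X) (x y u : c0 R) (g f : lip w X) (L e t m : R) :
  0 <= L -> (forall x y, `|h x - h y| <= L * `|x - y|) -> 0 <= t ->
  (L - 3 * e) * `|x - y| <= (h x - h y) g ->
  (1 + t) * (1 + m) * L <= L + e ->
  `|x - u| <= (1 + m) * (`|x - y| / 2) ->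
  `|u - y| <= (1 + m) * (`|x - y| / 2) ->
  omega_lipschitz w (1 + t) (g + f) -> omega_lipschitz w (1 + t) (g - f) ->
  `|(h x - h u - (h u - h y)) f| <= 4 * e * `|x - y|.
Proof.
move=> L0 hL t0 g_norming slack xu uy gf1 gf2.
have t10 : 0 <= 1 + t by rewrite addr_ge0.
have h1 := le_trans (hL x u) (ler_wpM2l L0 xu).
have h2 := le_trans (hL u y) (ler_wpM2l L0 uy).
rewrite (le_trans (lipfree_sandwich_norm t10 h1 h2 gf1 gf2))// addrA subrK.
have := ler_wpM2r (normr_ge0 (x - y)) slack; move: g_norming; clear; lra.
Qed.

(** The perturbations of g by f / 2 and by - f / 2 are admissible. *)
Lemma midpoint_defect (R : realType) (X : normedModType R) (w : R -> R)
    (h : c0 R -> lipfree w X) (x y u : c0 R) (g f : lip w X) (L K e s t m : R) :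
  gauge w -> 0 <= L -> (forall x y, `|h x - h y| <= L * `|x - y|) ->
  [/\ omega_lipschitz w 1 g, omega_lipschitz id K g,
    forall v, `|g v| <= K & forall v, K <= `|v| -> g v = 0] ->
  (L - 3 * e) * `|x - y| <= (h x - h y) g ->
  0 < K -> 0 < s -> 0 < t ->
  (forall a, 0 <= a -> a <= s -> K * a <= t * w a) ->
  (1 + t) * (1 + m) * L <= L + e ->
  `|x - u| <= (1 + m) * (`|x - y| / 2) ->
  `|u - y| <= (1 + m) * (`|x - y| / 2) ->
  omega_lipschitz w 2 f ->
  (forall v, `|f v| <= t * s) \/ (forall v, `|v| <= 2 * K + 4 / t -> f v = 0) ->
  `|(h x - h u - (h u - h y)) f| <= 8 * e * `|x - y|.
Proof.
move=> [w_ge w_le] L0 hL [g1 gK gb gs] gn K0 s0 t0 Ks slack xu uy f2 fgood.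
have defect := perturbation_defect L0 hL (ltW t0) gn slack xu uy.
pose f' := 2^-1 *: f.
have f'1 : omega_lipschitz w 1 f'.
  apply: omega_lipschitz_le (omega_lipschitzZ 2^-1 f2) => //.
    exact: gauge_ge0.
  by rewrite ger0_norm ?invr_ge0// mulVf.
have f'N : omega_lipschitz w 1 (- f') by exact: omega_lipschitzN.
have f'E v : f' v = 2^-1 * f v by [].
have f'NE v : (- f') v = - (2^-1 * f v) by [].
have -> : f = 2 *: f' by rewrite scalerA divff// scale1r.
rewrite lipfree_scaler normrM ger0_norm//.
suff : `|(h x - h u - (h u - h y)) f'| <= 4 * e * `|x - y| by clear; lra.
case: fgood => fgood.
  have fs v : `|2^-1 * f v| <= t * s / 2.
    by rewrite normrM ger0_norm ?invr_ge0// mulrC ler_wpM2r ?invr_ge0.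
  apply: defect.
    exact: (fine_perturbation w_ge s0 (ltW t0) Ks g1 gK f'1).
  apply: (fine_perturbation w_ge s0 (ltW t0) Ks g1 gK f'N) => v.
  by rewrite f'NE normrN.
apply: defect.
  apply: (far_perturbation w_ge w_le t0 K0 (lexx _) g1 gb gs f'1) => v vr.
  by rewrite f'E fgood ?mulr0.
apply: (far_perturbation w_ge w_le t0 K0 (lexx _) g1 gb gs f'N) => v vr.
by rewrite f'NE fgood ?mulr0 ?oppr0.
Qed.

(** Comparison of two functionals along the successive approximations f1, f2, f3
of f; only the last one needs information on both at once. *)
Lemma lipfree_telescope_le (R : realType) (X : normedModType R) (w : R -> R)
    (z1 z2 : lipfree w X) (f f1 f2 f3 : lip w X) (a b c : R) :
  (forall z, z = z1 \/ z = z2 -> [/\ `|z (f - f1)| <= a,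
    `|z (f1 - f2)| <= a & `|z (f2 - f3)| <= b]) ->
  `|z1 f3 - z2 f3| <= c -> (z1 - z2) f <= 4 * a + 2 * b + c.
Proof.
move=> zab z3.
have split_act (z : lipfree w X) : z f = z (f - f1) + z (f1 - f2) + z (f2 - f3) + z f3.
  by rewrite !lipfree_addr !lipfree_oppr; ring.
have [p1 p2 p3] := zab z1 (or_introl erefl).
have [q1 q2 q3] := zab z2 (or_intror erefl).
have -> : (z1 - z2) f = z1 f - z2 f by [].
rewrite !split_act; move: p1 p2 p3 q1 q2 q3 z3; rewrite !ler_norml.
move: (z1 _) (z1 _) (z1 _) (z1 _) (z2 _) (z2 _) (z2 _) (z2 _).
by clear; move=> r1 r2 r3 r4 r5 r6 r7 r8; do 7!move=> /andP[? ?]; lra.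
Qed.

(** The constants are fixed in the order t, s, K', s', d, A, and only then is the
pair chosen, with the finite set E that depends on it. The defects D_n of the
midpoints u_n are pairwise close since each is nearly determined by its values
on a finite net. *)
Lemma near_midpoints_collapse (R : realType) (X : normedModType R) (w : R -> R)
    (h : c0 R -> lipfree w X) (L K e : R) : gauge w -> steep w ->
  0 <= L -> (forall x y, `|h x - h y| <= L * `|x - y|) -> 0 < K -> 0 < e -> e <= L ->
  (exists x y (g : lip w X), [/\ x != y,
    [/\ omega_lipschitz w 1 g, omega_lipschitz id K g,
      forall v, `|g v| <= K & forall v, K <= `|v| -> g v = 0] &
    (L - e) * `|x - y| <= (h x - h y) g]) ->
  exists x y u1 u2 : c0 R, [/\ x != y, `|x - y| / 2 <= `|u1 - u2| &
    `|h u1 - h u2| <= 20 * e * `|x - y|].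
Proof.
move=> wg w_steep L0 hL K0 e0 eL norming; have [w_ge w_le] := wg.
have [t [t0 t1 tL]] : exists t : R, [/\ 0 < t, t <= 1 & t * L <= e / 4].
  have l0 : 0 < 4 * (L + 1) by rewrite mulr_gt0// ltr_wpDl.
  exists (e / (4 * (L + 1))); split; first exact: divr_gt0.
    by rewrite ler_pdivrMr// mul1r; move: L0 eL; clear; lra.
  rewrite mulrAC ler_pdivrMr//; have := mulr_ge0 (ltW e0) L0.
  by move: e0; clear; lra.
have [s s0 Ks] := steepM K w_steep t0.
have r0 : 0 <= 2 * K + 4 / t.
  by rewrite addr_ge0 ?divr_ge0 ?mulr_ge0// ltW.
have [K' K'1 decomp] := lip_decomposition X w_ge w_le (mulr_gt0 t0 s0) r0.
have K'0 : 0 < K' := lt_le_trans ltr01 K'1.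
have [s' s'0 Ks'] := steepM (2 * K') w_steep t0.
(* 2 K'-Lipschitz functions vary by at most 4 K' d on the 2 d-neighbourhood of E;
   with the error t s' / 4 on E this stays below the truncation level t s' / 2 *)
have [d [d0 dE]] : exists d : R, 0 < d /\ 4 * K' * d = t * s' / 4.
  exists (t * s' / 4 / (4 * K')); split.
    by rewrite !divr_gt0 ?mulr_gt0.
  by field; rewrite gt_eqF.
have [A [A1 Ad]] : exists A : R, 1 <= A /\ 2 <= A * d.
  exists (2 / d + 1); split; first by rewrite lerDr divr_ge0 ?(ltW d0).
  by rewrite mulrDl mul1r divfK ?gt_eqF// lerDl ltW.
have A0 : 0 < A := lt_le_trans ltr01 A1.
pose G : set (lip w X) := [set g | [/\ omega_lipschitz w 1 g,
  omega_lipschitz id K g, forall v, `|g v| <= K &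
  forall v, K <= `|v| -> g v = 0]].
have G1 g : G g -> omega_lipschitz w 1 g by case.
have z0 : 0 < e / (8 * K') by rewrite divr_gt0 ?mulr_gt0.
have [x [y [g [m [E [xy Gg /andP[m0 mt] gn tight]]]]]] :=
  penalised_maximal_pair wg L0 hL G1 norming A0 d0 Ad e0 t0 z0.
have [u [xu uy usep]] := c0_midpoints m0 xy.
set rr := `|x - y| in gn xu uy usep tight *.
have rr0 : 0 < rr by rewrite normr_gt0 subr_eq0.
pose D i := h x - h (u i) - (h (u i) - h y).
have slack : (1 + t) * (1 + m) * L <= L + e.
  have mL : m * L <= t * L by rewrite ler_wpM2r.
  have : t * (m * L) <= m * L by rewrite ler_piMl// mulr_ge0// ltW.
  by move: mL tL e0; clear; lra.
have Dnorm i : `|D i| <= 2 * L * rr.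
  rewrite (le_trans (ler_normB _ _))//.
  have := le_trans (hL x (u i)) (ler_wpM2l L0 (xu i)).
  have := le_trans (hL (u i) y) (ler_wpM2l L0 (uy i)).
  have : (1 + m) * (rr / 2) <= rr.
    rewrite mulrA ler_pdivrMr// mulrC ler_wpM2l ?(ltW rr0)//.
    by move: (le_trans mt t1); clear; lra.
  by move=> /(ler_wpM2l L0); clear; lra.
pose S : set (lip w X) := [set f | [/\ omega_lipschitz w 1 f,
  omega_lipschitz id K' f & forall v, `|f v| <= K']].
have th0 : 0 < t * s' / 4 by rewrite divr_gt0 ?mulr_gt0.
have [i [j [ij close]]] : exists n m, n != m /\ forall f, S f -> exists f',
    [/\ S f', forall v, v \in E -> `|f v - f' v| <= t * s' / 4 &
        `|D n f' - D m f'| <= e * rr].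
  apply: (@totally_bounded_pigeonhole R (lip w X) X (fun f v => f v) S E K' (2 * L * rr)
    (t * s' / 4) (e * rr) (fun n f => D n f)) => //; first exact: mulr_gt0.
  - exists 0; split.
    + apply: (@omega_lipschitz_le _ _ w 0) => //; first exact: gauge_ge0.
      exact: (omega_lipschitz_cst 0 (gauge_ge0 w_ge)).
    + by move=> v v'; rewrite -[X in `|X|]/(0 - 0 : R) subrr normr0 mulr_ge0// ltW.
    + by move=> v; rewrite -[X in `|X|]/(0 : R) normr0 ltW.
  - by move=> f v [].
  - move=> n f [f1 _ _]; rewrite (le_trans (lipfree_act_le (D n) ler01 f1))//.
    by rewrite mul1r.
have le_e n f f' : S f -> S f' ->
    (forall v, v \in E -> `|f v - f' v| <= t * s' / 4) ->
    D n (f - f') <= e * rr.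
  move=> [f1 fK fb] [f'1 f'K f'b] ff'.
  have thd : t * s' / 4 + 4 * K' * d <= t * s' / 2 by rewrite dE; clear; lra.
  have := lipfree_act_close w_ge A1 K'1 d0 s'0 (ltW t0) Ks' thd (ltW th0)
    (fun b Qb bE => tight (u n) b (xu n) (uy n) Qb bE) f1 f'1 fK f'K fb f'b ff'.
  move/le_trans; apply.
  have -> : 4 * K' * (e / (8 * K') * rr) = e * rr / 2 by field; rewrite gt_eqF.
  have := ler_wpM2l (ltW t0) (Dnorm n).
  have := ler_wpM2r (ltW rr0) tL.
  by clear; lra.
have norm_e n f f' : S f -> S f' ->
    (forall v, v \in E -> `|f v - f' v| <= t * s' / 4) ->
    `|D n (f - f')| <= e * rr.
  move=> Sf Sf' ff'; rewrite ler_norml le_e// andbT lerNl -lipfree_oppr opprB.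
  by rewrite le_e// => v vE; rewrite distrC ff'.
have Dgood n f := midpoint_defect wg L0 hL Gg gn K0 s0 t0 Ks slack (xu n) (uy n) (f := f).
exists x, y, (u i), (u j); split=> //; first exact: usep.
have Dij : `|D i - D j| <= 40 * e * rr.
  apply: lipfree_norm_le => // f f1.
  have [f1' [f2 [[f1'1 f21 f2K] [ff1 f12 f2b _]]]] := decomp f f1.
  have Sf2 : S f2 by [].
  have [f3 [Sf3 f23 cl]] := close f2 Sf2.
  (* four times 8 e for the tiny and the far parts, the rest for the net *)
  have -> : 40 * e * rr = 4 * (8 * e * rr) + 2 * (e * rr) + 6 * (e * rr) by ring.
  apply: (lipfree_telescope_le (f1 := f1') (f2 := f2) (f3 := f3)); last first.
    by rewrite (le_trans cl)// ler_peMl ?mulr_ge0 ?(ltW e0) ?(ltW rr0)// ler1n.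
  suff Dn n : [/\ `|D n (f - f1')| <= 8 * e * rr, `|D n (f1' - f2)| <= 8 * e * rr
      & `|D n (f2 - f3)| <= e * rr] by move=> z [->|->]; exact: Dn.
  split; [apply: Dgood|apply: Dgood|exact: norm_e].
  - exact: (omega_lipschitzB f1 f1'1).
  - by left.
  - exact: (omega_lipschitzB f1'1 f21).
  - by right=> v vr; rewrite -[LHS]/(f1' v - f2 v) f12// subrr.
have DE : D j - D i = 2 *: (h (u i) - h (u j)).
  have DnE n : D n = h x + h y - (h (u n) + h (u n)) by rewrite /D opprB addrACA opprD.
  rewrite !DnE opprB addrC addrA subrK scaler_nat mulr2n opprD.
  by rewrite [RHS]addrACA.
have : 2 * `|h (u i) - h (u j)| <= 40 * e * rr.
  by rewrite -[2]ger0_norm// -normrZ -DE distrC.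
by rewrite -/rr; clear; lra.
Qed.

(** The midpoints are |x - y| / 2 apart, so the collapse of their images contradicts
the lower Lipschitz bound c. *)
Theorem c0_not_lipschitz_embeddable (R : realType) (X : normedModType R)
    (w : R -> R) (h : c0 R -> lipfree w X) (H c : R) : gauge w -> steep w ->
  (forall x y, `|h x - h y| <= H * `|x - y|) -> 0 < c ->
  ~ (forall x y, c * `|x - y| <= `|h x - h y|).
Proof.
move=> wg w_steep hH c_gt0 hc; have [w_ge w_le] := wg.
pose G1 : set (lip w X) := [set g | omega_lipschitz w 1 g].
have [L [L0 hLg nearL]] : exists L : R, [/\ 0 <= L,
    forall x y g, G1 g -> (h x - h y) g <= L * `|x - y| &
    forall t, 0 < t -> exists x y g,
      [/\ x != y, G1 g & (L - t) * `|x - y| <= (h x - h y) g]].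
  apply: (slopes_sup hH ler01) => //; exists 0.
  apply: (@omega_lipschitz_le _ _ w 0) => //; first exact: gauge_ge0.
  exact: (omega_lipschitz_cst 0 (gauge_ge0 w_ge)).
have hL x y : `|h x - h y| <= L * `|x - y|.
  by apply: lipfree_norm_le => // f f1; exact: hLg.
(* 20 e < c / 2 *)
pose e := c / 50.
have e0 : 0 < e by exact: divr_gt0.
have eL : e <= L.
  have [x [y [_ [xy _ _]]]] := nearL 1 ltr01.
  have r0 : 0 < `|x - y| by rewrite normr_gt0 subr_eq0.
  rewrite (@le_trans _ _ c)//; last first.
    by rewrite -(ler_pM2r r0) (le_trans (hc x y)).
  by rewrite /e; move: c_gt0; clear; lra.
have [x [y [f [xy f1 fn]]]] := nearL _ (divr_gt0 e0 (ltr0Sn _ 1)).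
have r0 : 0 < `|x - y| by rewrite normr_gt0 subr_eq0.
have [K [g [[K1 g1 gK] [gb g0 gn]]]] :=
  lipfree_smooth_norming w_ge w_le (h x - h y)
    (mulr_gt0 (divr_gt0 e0 (ltr0Sn _ 1)) r0) f1.
have [|x' [y' [u1 [u2 [xy' usep hu]]]]] :=
  near_midpoints_collapse wg w_steep L0 hL (lt_le_trans ltr01 K1) e0 eL.
  by exists x, y, g; split=> //; move: fn gn; clear; lra.
have r'0 : 0 < `|x' - y'| by rewrite normr_gt0 subr_eq0.
have := hc u1 u2; have := ler_wpM2l (ltW c_gt0) usep.
have := mulr_gt0 c_gt0 r'0; move: hu; rewrite /e; clear; lra.
Qed.

(** * Completeness *)

Section completeness.
Context (R : realType).
Implicit Types V W : normedModType R.

Definition norm_cauchy V (F : set_system V) :=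
  forall e : R, 0 < e -> exists v, F [set u | `|v - u| < e].

Lemma banachP V : banach V <-> forall F : set_system V, ProperFilter F ->
  norm_cauchy F -> exists v, forall e : R, 0 < e -> F [set u | `|v - u| < e].
Proof.
have ballE (v : V) e : ball v e = [set u | `|v - u| < e] by rewrite -ball_normE.
split=> [bV F FF Fc|bV F FF Fc].
  exists (lim F) => e e0; rewrite -ballE.
  have /fcvg_ballP : cvg F; last exact.
  by apply: bV; apply: cauchy_exP => d /Fc[v Fv]; exists v; rewrite ballE.
have [e e0|v vF] := bV F FF _.
  by have /cauchyP/(_ e e0)[v] := Fc; rewrite ballE => Fv; exists v.
apply: (@cvgP _ _ v); apply/fcvg_ballP => e e0.
by have := vF e e0; rewrite -ballE.
Qed.

(** A Cauchy filter converges along each functional L i, uniformly with respect to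
the weights w; hence the norm limit exists as soon as the family of limits l is
realised by a vector. *)
Lemma banach_least_constant V (I : Type) (L : I -> V -> R) (w : I -> R) :
  (forall i, 0 <= w i) -> (forall i u v, L i (u - v) = L i u - L i v) ->
  (forall v i, `|L i v| <= `|v| * w i) ->
  (forall v C, 0 <= C -> (forall i, `|L i v| <= C * w i) -> `|v| <= C) ->
  (forall l : I -> R, (forall e : R, 0 < e -> exists u, forall i,
     `|L i u - l i| <= e * w i) -> exists v, forall i, L i v = l i) ->
  banach V.
Proof.
move=> w0 LB Lub Llb Lcomplete; apply/banachP => F FF Fc.
have Li e v i u : `|v - u| < e -> `|L i v - L i u| <= e * w i.
  by move=> vu; rewrite -LB (le_trans (Lub _ _))// ler_wpM2r// ltW.
have /choice[l lP] i : exists l : R, forall e : R, 0 < e ->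
    F [set u | `|l - L i u| <= e * w i].
  have : cvg (L i @ F).
    apply: R_complete; apply/cauchy_exP => e e0.
    have w1 : 0 < w i + 1 by rewrite ltr_wpDl.
    have [v vF] := Fc _ (divr_gt0 e0 w1).
    exists (L i v); rewrite -ball_normE.
    have : F [set u | `|L i v - L i u| < e]; last by [].
    apply: filterS vF => u /= vu.
    rewrite (le_lt_trans (Li _ _ i _ vu))// mulrAC ltr_pdivrMr// ltr_pM2l//.
    by rewrite ltrDl.
  move=> Lcvg; exists (lim (L i @ F)) => e e0.
  have [wi|wi] := eqVneq (w i) 0.
    have [v vF] := Fc 1 ltr01.
    have Lconst u : L i u = 0.
      by apply/eqP; rewrite -normr_le0 (le_trans (Lub _ _))// wi mulr0.
    have -> : lim (L i @ F) = 0.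
      have -> : L i = cst 0 by apply/funext.
      exact: lim_cst.
    by apply: filterS vF => u _ /=; rewrite Lconst subrr normr0 wi mulr0.
  move/cvgrPdist_le : Lcvg; apply; rewrite mulr_gt0// lt_neqAle eq_sym wi.
  exact: w0.
have approx e v : 0 < e -> F [set u | `|v - u| < e] ->
    forall i, `|L i v - l i| <= e * w i.
  move=> e0 vF i; apply/ler_addgt0Pr => d d0.
  have w1 : 0 < w i + 1 by rewrite ltr_wpDl.
  have [u [/= /(Li _ _ i) vu ul]] := filter_ex (filterI vF (lP i _ (divr_gt0 d0 w1))).
  have -> : L i v - l i = (L i v - L i u) - (l i - L i u) by rewrite opprB addrA subrK.
  rewrite (le_trans (ler_normB _ _))// lerD// (le_trans ul)//.
  by rewrite mulrAC ler_pdivrMr// ler_wpM2l ?(ltW d0)// lerDl.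
have [e e0|v vl] := Lcomplete l.
  by have [u uF] := Fc e e0; exists u; exact: approx.
exists v => e e0; have e20 : 0 < e / 2 by rewrite divr_gt0.
have [u uF] := Fc _ e20.
have uv : `|u - v| <= e / 2.
  by apply: Llb => [|i]; [exact: ltW|rewrite LB vl; exact: approx].
apply: filterS uF => x /= ux; rewrite -(subrK u v) -addrA.
by rewrite (le_lt_trans (ler_normD _ _))// (splitr e) ler_ltD// distrC.
Qed.

Lemma banach_isometric_closed V W (f : {linear V -> W}) : banach W ->
  (forall v, `|f v| = `|v|) -> closure (range f) `<=` range f -> banach V.
Proof.
move=> /banachP bW fE fcl; apply/banachP => F FF Fc.
have fB u v : `|f u - f v| = `|u - v| by rewrite -linearB fE.
have [e e0|y yF] := bW (f @ F) _ _.
  have [v vF] := Fc e e0; exists (f v).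
  have : F [set u | `|f v - f u| < e] by under eq_set do rewrite fB.
  by [].
have {}yF e : 0 < e -> F [set u | `|y - f u| < e] by exact: yF.
have [v _ vy] : range f y.
  apply: fcl; apply/closureP => e e0.
  by have [u /= uy] := filter_ex (yF e e0); exists (f u) => //; exists u.
exists v => e e0; have := yF e e0; apply: filterS => u /=.
by rewrite -vy fB.
Qed.

Lemma banach_c0 : banach (c0 R).
Proof.
apply: (@banach_least_constant (c0 R) nat (fun n u => u n) (fun=> 1)) => //.
- by move=> u n; rewrite mulr1 c0_coord_le.
- move=> u C C0 uC; apply: c0_norm_le => n.
  by rewrite (le_trans (uC n))// mulr1.
- move=> l lP; have l0 : l \in @c0_pred R.
    apply/mem_set/cvgr0Pnorm_lt => e e0; have e20 : 0 < e / 2 by rewrite divr_gt0.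
    have [u uP] := lP _ e20.
    have /cvgr0Pnorm_lt/(_ _ e20) := @c0_cvg R u.
    apply: filterS => n un; rewrite -[l n](subrK (u n)).
    rewrite (le_lt_trans (ler_normD _ _))// (splitr e) ler_ltD//.
    by rewrite distrC -[leRHS]mulr1.
  by exists (C0 l0).
Qed.

Lemma banach_cdual V : banach (cdual V).
Proof.
apply: (@banach_least_constant (cdual V) V (fun v phi => phi v) (fun v => `|v|)) => //.
- by move=> phi v; exact: cdual_normP.
- move=> phi C C0 phiC; apply: ge_sup; first by exists `|phi 0|, 0 => //=; rewrite normr0.
  move=> _ [v /= v1 <-]; rewrite (le_trans (phiC v))//.
  by rewrite -[leRHS]mulr1 ler_wpM2l.
- move=> l lP.
  have llin : linear l.
    move=> a x y; apply/eqP; rewrite -subr_eq0 -normr_le0.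
    apply/ler_addgt0Pr => e e0; rewrite add0r.
    pose M := `|a *: x + y| + (`|a| * `|x| + `|y|).
    have M0 : 0 <= M by rewrite !addr_ge0// mulr_ge0.
    have M1 : 0 < M + 1 by rewrite ltr_wpDl.
    have [u uP] := lP _ (divr_gt0 e0 M1).
    have -> : l (a *: x + y) - (a *: l x + l y) =
        - (u (a *: x + y) - l (a *: x + y)) + (a * (u x - l x) + (u y - l y)).
      by rewrite (cdual_linear u) /GRing.scale/=; ring.
    rewrite (le_trans (ler_normD _ _))// normrN.
    rewrite (le_trans (lerD (lexx _) (ler_normD _ _)))// normrM.
    rewrite (le_trans (lerD (uP _) (lerD (ler_wpM2l (normr_ge0 a) (uP x)) (uP y))))//.
    rewrite mulrCA -!mulrDr -/M mulrAC ler_pdivrMr// ler_wpM2l ?(ltW e0)//.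
    by rewrite lerDl.
  have lcont : continuous l.
    pose lL : {linear V -> R} := HB.pack l (GRing.isLinear.Build _ _ _ _ _ llin).
    apply: (@bounded_linear_continuous _ _ _ lL).
    have [u uP] := lP 1 ltr01.
    apply/linear_boundedP.
    apply: filterS (nbhs_pinfty_ge (num_real (`|u| + 1))) => M uM v.
    have -> : lL v = u v - (u v - l v) by rewrite subKr.
    rewrite (le_trans (ler_normB _ _))//.
    rewrite (le_trans (lerD (cdual_normP u v) (uP v)))// -mulrDl.
    by rewrite ler_wpM2r.
  have lcd : l \in @cdual_pred R V by apply/mem_set.
  by exists (CDual lcd).
Qed.

Lemma banach_lipfree (w : R -> R) (X : normedModType R) : banach (lipfree w X).
Proof.
apply: (@banach_isometric_closed _ _ (val : {linear lipfree w X -> _})).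
- exact: banach_cdual.
- by [].
- move=> phi /closureP phiP.
  have phiF : phi \in @lipfree_pred R w X.
    apply/mem_set; apply/closureP => e e0; have e20 : 0 < e / 2 by rewrite divr_gt0.
    have [_ [psi _ <-] phipsi] := phiP _ e20.
    have /set_mem/closureP/(_ _ e20)[u Au psiu] := lipfree_valP psi.
    exists u => //; rewrite -(subrK (val psi) phi) -addrA.
    by rewrite (le_lt_trans (ler_normD _ _))// (splitr e) ltrD.
  by exists (LipFree phiF).
Qed.

Lemma banach_lin_ker V W (f : {linear V -> W}) : continuous f -> banach V ->
  banach (lin_ker f).
Proof.
move=> fc bV; apply: (@banach_isometric_closed _ _ (val : {linear lin_ker f -> _})) => //.
move=> v /closureP vP.
have vK : v \in lin_ker_pred f.
  apply/mem_set => /=; apply/eqP; rewrite -normr_le0; apply/ler_addgt0Pr => e e0.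
  have /cvgrPdist_le/(_ _ e0)/nbhs_ballP[d /= d0 vd] := fc v.
  have [_ [u _ <-] vu] := vP d d0.
  have := vd (val u); rewrite -ball_normE => /(_ vu).
  by have /set_mem/= -> := lin_ker_valP u; rewrite subr0 add0r.
by exists (LinKer vK).
Qed.

Lemma banach_l1sum V W : banach V -> banach W -> banach (l1sum V W).
Proof.
move=> /banachP bV /banachP bW; apply/banachP => F FF Fc.
have [e e0|v vF] := bV (fst @ F) _ _.
  have [z zF] := Fc e e0; exists z.1.
  have : F [set u | `|z.1 - u.1| < e]; last by [].
  apply: filterS zF => u zu.
  by apply: le_lt_trans zu; rewrite -[leRHS]/(`|z.1 - u.1| + `|z.2 - u.2|) lerDl.
have [e e0|y yF] := bW (snd @ F) _ _.
  have [z zF] := Fc e e0; exists z.2.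
  have : F [set u | `|z.2 - u.2| < e]; last by [].
  apply: filterS zF => u zu.
  by apply: le_lt_trans zu; rewrite -[leRHS]/(`|z.1 - u.1| + `|z.2 - u.2|) lerDr.
have {}vF e : 0 < e -> F [set u | `|v - u.1| < e] by exact: vF.
have {}yF e : 0 < e -> F [set u | `|y - u.2| < e] by exact: yF.
exists ((v, y) : l1sum V W) => e e0; have e20 : 0 < e / 2 by rewrite divr_gt0.
apply: filterS (filterI (vF _ e20) (yF _ e20)) => u [/= v1 v2].
by rewrite -[ltLHS]/(`|v - u.1| + `|y - u.2|) (splitr e) ltrD.
Qed.

End completeness.

(** * Separability *)

Section separability.
Context (R : realType).
Implicit Types V W X : normedModType R.

Definition dense_sequence V (d : nat -> V) :=
  forall v (e : R), 0 < e -> exists n, `|v - d n| < e.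

Lemma dense_sequence_separable V (d : nat -> V) : dense_sequence d -> separable V.
Proof.
move=> dd; exists (range d); first exact: card_image_le.
move=> O [v Ov] Oo; have : nbhs v O by exact: open_nbhs_nbhs.
move=> /nbhs_ballP[e /= e0 veO]; have [n vn] := dd v e e0.
by exists (d n); split; [apply: veO; rewrite -ball_normE|exists n].
Qed.

Lemma countType_dense_sequence V (T : countType) (f : T -> V) :
  (forall v (e : R), 0 < e -> exists t, `|v - f t| < e) ->
  exists d : nat -> V, dense_sequence d.
Proof.
move=> fd; exists (fun n => if unpickle n is Some t then f t else 0).
by move=> v e /(fd v)[t vt]; exists (pickle t); rewrite pickleK.
Qed.

Lemma dense_sequence_image V W (f : V -> W) : continuous f ->
  (forall w, exists v, f v = w) -> (exists d : nat -> V, dense_sequence d) ->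
  exists d : nat -> W, dense_sequence d.
Proof.
move=> fc fs [d dd]; exists (f \o d) => w e e0.
have [v <-] := fs w.
have /cvgrPdist_lt/(_ _ e0)/nbhs_ballP[r /= r0 vr] := fc v.
have [n vn] := dd v r r0; exists n => /=.
by apply: vr; rewrite -ball_normE.
Qed.

Lemma rat_approx (a e : R) : 0 < e -> exists q : rat, `|a - ratr q| < e.
Proof.
move=> e0; have /rat_in_itvoo[q] : a - e < a + e by rewrite ltrBlDr -addrA ltrDl addr_gt0.
rewrite in_itv/= => /andP[? ?]; exists q.
by rewrite ltr_norml; apply/andP; split; lra.
Qed.

Lemma c0_dense_sequence : exists d : nat -> c0 R, dense_sequence d.
Proof.
have /choice[f fE] (s : seq rat) : exists u : c0 R, forall n, u n = ratr (nth 0 s n).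
  have sP : (fun n => ratr (nth 0 s n) : R) \in @c0_pred R.
    apply/mem_set => /=; apply: cvg_near_cst; exists (size s) => // n /= sn.
    by rewrite nth_default// rmorph0.
  by exists (C0 sP).
apply: (countType_dense_sequence (f := f)) => u e e0.
have e20 : 0 < e / 2 by rewrite divr_gt0.
have /cvgr0Pnorm_lt/(_ _ e20)[N _ uN] := @c0_cvg R u.
have /choice[q qP] n := rat_approx (u n) e20.
exists (mkseq q N); rewrite (@le_lt_trans _ _ (e / 2))//; last lra.
apply: c0_norm_le => n; rewrite c0_coordD c0_coordN fE.
have [nN|nN] := ltnP n N; first by rewrite nth_mkseq// ltW.
by rewrite nth_default ?size_mkseq// rmorph0 subr0 ltW// uN.
Qed.

Section lipfree.
Variables (X : normedModType R) (w : R -> R).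
Hypothesis w_ge : forall t, 0 <= t -> t <= w t.
Hypothesis w_le : forall t, 0 <= t -> w t <= t + 4 * Num.sqrt t.

Lemma delta_dist (x y : X) : `|delta w x - delta w y| <= w `|x - y|.
Proof.
apply: lipfree_norm_le => // f f1; rewrite -[w _]mul1r.
exact: le_trans (ler_norm _) (f1 x y).
Qed.

Lemma gauge_small (e : R) : 0 < e -> exists2 d : R, 0 < d &
  forall t, 0 <= t -> t < d -> w t <= e.
Proof.
move=> e0; have e20 : 0 < e / 2 by rewrite divr_gt0.
have K0 : 0 < 1 + 4 / (e / 2) by rewrite ltr_wpDr// divr_ge0// ltW.
exists (e / 2 / (1 + 4 / (e / 2))); first exact: divr_gt0.
move=> t t0; rewrite ltr_pdivlMr// mulrC => td.
rewrite (le_trans (gauge_le_affine w_le e20 t0))// [leRHS](splitr e).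
by rewrite lerD// ltW.
Qed.

(** Finite combinations with rational coefficients of the delta of a dense sequence,
as delta is continuous. *)
Lemma lipfree_dense_sequence : (exists d : nat -> X, dense_sequence d) ->
  exists d : nat -> lipfree w X, dense_sequence d.
Proof.
move=> [d dd].
pose f (s : seq (rat * nat)) : lipfree w X :=
  \sum_(p <- s) (ratr p.1 : R) *: delta w (d p.2).
pose P z := forall e : R, 0 < e -> exists s, `|z - f s| < e.
have P0 : P 0 by move=> e e0; exists [::]; rewrite /f big_nil subrr normr0.
have PD u v : P u -> P v -> P (u + v).
  move=> Pu Pv e e0; have e20 : 0 < e / 2 by rewrite divr_gt0.
  have [s us] := Pu _ e20; have [t vt] := Pv _ e20.
  exists (s ++ t); rewrite /f big_cat/= -/(f s) -/(f t) opprD addrACA.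
  by rewrite (le_lt_trans (ler_normD _ _))// (splitr e) ltrD.
have Pdelta (a : R) (x : X) : P (a *: delta w x).
  move=> e e0; have e40 : 0 < e / 2 by rewrite divr_gt0.
  have n0 : 0 < `|delta w x| + 1 by rewrite ltr_wpDl.
  have [q aq] := rat_approx a (divr_gt0 e40 n0).
  have q0 : 0 < `|ratr q : R| + 1 by rewrite ltr_wpDl.
  have [r r0 wr] := gauge_small (divr_gt0 e40 q0).
  have [n xn] := dd x r r0.
  exists [:: (q, n)]; rewrite /f big_seq1/=.
  have -> : a *: delta w x - ratr q *: delta w (d n) =
      (a - ratr q) *: delta w x + ratr q *: (delta w x - delta w (d n)).
    by rewrite scalerBl scalerBr addrA subrK.
  rewrite (le_lt_trans (ler_normD _ _))// (splitr e) (normrZ (a - _)) (normrZ (ratr q)) ltr_leD//.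
    apply: le_lt_trans (_ : `|a - ratr q| * (`|delta w x| + 1) < _).
      by rewrite ler_wpM2l// lerDl.
    by rewrite -ltr_pdivlMr.
  apply: le_trans (_ : (`|ratr q| + 1) * (e / 2 / (`|ratr q| + 1)) <= _).
    have xnw := le_trans (delta_dist x (d n)) (wr _ (normr_ge0 _) xn).
    by rewrite (le_trans (ler_wpM2l (normr_ge0 _) xnw))// ler_wpM2r ?lerDl// divr_ge0 ?ltW.
  by rewrite mulrCA divff ?mulr1// gt_eqF.
apply: (countType_dense_sequence (f := f)) => z e e0.
have e20 : 0 < e / 2 by rewrite divr_gt0.
have [n [a [x zx]]] := lipfree_approx z e20.
have : P (\sum_(i < n) a i *: delta w (x i)).
  by apply: (big_ind P P0 PD) => i _; exact: Pdelta.
move=> /(_ _ e20)[s fs]; exists s.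
rewrite -(subrK (\sum_(i < n) a i *: delta w (x i)) z) -addrA.
by rewrite (le_lt_trans (ler_normD _ _))// (splitr e) ltrD.
Qed.

End lipfree.
End separability.

(** * The gauge omega *)

Section omega_estimates.
Context (R : realType) (alpha : R).
Hypothesis alpha_gt0 : 0 < alpha.
Hypothesis alpha_le2 : alpha <= 2.
Implicit Types (t r M : R).

Lemma expRN1_bounds : 4^-1 <= expR (- 1 : R) < 1.
Proof.
apply/andP; split; last by rewrite expR_lt1 ltrN10.
have : 2^-1 <= expR (- 2^-1 : R).
  by rewrite (le_trans _ (expR_ge1Dx _))//; lra.
have -> : expR (- 1 : R) = expR (- 2^-1) ^+ 2.
  by rewrite -expRM_natl; congr expR; field.
by move=> h; rewrite expr2 (le_trans _ (ler_pM _ _ h h))// ?invr_ge0//; lra.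
Qed.

Lemma omega0 : omega alpha 0 = 0 :> R.
Proof. by rewrite /omega lexx. Qed.

Lemma omega_small t : 0 < t -> t < expR (- 1) ->
  omega alpha t = t * (`|ln t| `^ alpha + 1).
Proof. by move=> t0 te; rewrite /omega leNgt t0 te. Qed.

Lemma norm_ln t : 0 < t -> t <= 1 -> `|ln t| = - ln t.
Proof. by move=> t0 t1; rewrite ler0_norm// ln_le0. Qed.

Lemma ln_ge t M : 0 < t -> 0 <= M -> t <= expR (- M) -> M <= `|ln t|.
Proof.
move=> t0 M0 tM; have t1 : t <= 1 by rewrite (le_trans tM)// expR_le1 oppr_le0.
by rewrite norm_ln// lerNr -[leRHS]expRK ler_ln// posrE expR_gt0.
Qed.

(** With t = p^8 and L = |ln t|, the inequality 1 + L / 8 <= exp (L / 8) = 1 / p gives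
p L <= 8 (1 - p), so p (p L) <= 8 p (1 - p) <= 2; this is t L^2 <= 4 p^4. *)
Lemma mul_ln_powR_le t : 0 < t -> t <= expR (- 1) ->
  t * `|ln t| `^ alpha <= 4 * Num.sqrt t.
Proof.
move=> t0 te; have L1 : 1 <= `|ln t| by apply: ln_ge.
have L2 : `|ln t| `^ alpha <= `|ln t| ^+ 2.
  by rewrite -powR_mulrn ?ler_powR.
have [_ e1] := andP expRN1_bounds.
have t1 : t <= 1 by rewrite (le_trans te)// ltW.
pose L := `|ln t|; pose p := expR (- (L / 8)).
have p0 : 0 < p := expR_gt0 _.
have pn n : p ^+ n = expR (- (n%:R * (L / 8))) by rewrite -expRM_natl mulrN.
have tp : t = p ^+ 8.
  rewrite pn mulrC divfK// /L norm_ln// opprK lnK//.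
have -> : Num.sqrt t = p ^+ 4.
  by rewrite tp -[8%N]/(4 * 2)%N exprM sqrtr_sqr ger0_norm// exprn_ge0// ltW.
rewrite (le_trans (ler_wpM2l (ltW t0) L2))// -/L tp.
have pL : 0 <= p * L <= 8 * (1 - p).
  have L0 : 0 <= L by exact: normr_ge0.
  rewrite mulr_ge0 ?(ltW p0)//=.
  have : p * (1 + L / 8) <= 1.
    by rewrite /p expRN mulrC ler_pdivrMr ?expR_gt0// mul1r expR_ge1Dx.
  lra.
have -> : p ^+ 8 * L ^+ 2 = p ^+ 4 * (p * (p * L)) ^+ 2 by ring.
rewrite [leRHS]mulrC ler_wpM2l ?exprn_ge0 ?(ltW p0)//.
have -> : 4 = 2 ^+ 2 :> R by ring.
have [pL0 pL1] := andP pL.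
have ppL : 0 <= p * (p * L) := mulr_ge0 (ltW p0) pL0.
rewrite ler_pXn2r ?nnegrE//.
have := sqr_ge0 (2 * p - 1).
have := ler_wpM2l (ltW p0) pL1.
by rewrite expr2; lra.
Qed.

(** Below 1 / e this is the previous bound; on [1 / e, 1] the affine piece is at most
t + 1, and 1 <= 4 sqrt t as t >= 1 / 4 there. *)
Lemma omega_gauge : gauge (@omega R alpha).
Proof.
split=> [t|t t0]; first exact: omega_ge.
have [->|tn0] := eqVneq t 0; first by rewrite omega0 sqrtr0 mulr0 addr0.
have {tn0}t0 : 0 < t by rewrite lt_neqAle eq_sym tn0.
have [te|te] := ltP t (expR (- 1)).
  rewrite omega_small// mulrDr mulr1 addrC lerD2l.
  by rewrite mul_ln_powR_le// ltW.
have s0 : 0 <= Num.sqrt t by exact: sqrtr_ge0.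
rewrite /omega [t <= 0]leNgt t0 [t < expR _]ltNge te /=; case: ifPn => t1; last by lra.
have e2 : 2 <= expR 1 :> R by rewrite (le_trans _ (expR_ge1Dx _))//; lra.
have s1 : 2^-1 <= Num.sqrt t.
  rewrite -[2^-1 : R]ger0_norm ?invr_ge0// -sqrtr_sqr ler_wsqrtr//.
  have [e4 _] := andP expRN1_bounds.
  rewrite (le_trans _ te)// (le_trans _ e4)//.
  by rewrite expr2; lra.
have b1 : (expR 1 - 1)^-1 <= 1 :> R by rewrite invf_le1; lra.
have a1 : (expR 1 - 2) / (expR 1 - 1) <= 1 :> R by rewrite ler_pdivrMr; lra.
by have := ler_wpM2r (ltW t0) a1; lra.
Qed.

Lemma omega_steep : steep (@omega R alpha).
Proof.
move=> K; pose M := (`|K| + 1) `^ alpha^-1 + 1.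
have K1 : 0 <= `|K| + 1 by rewrite addr_ge0.
have M1 : 1 < M.
  by rewrite /M ltrDr powR_gt0// ltr_wpDl.
exists (expR (- M)); first exact: expR_gt0.
move=> t; rewrite le_eqVlt => /predU1P[<-|t0] tM; first by rewrite omega0 mulr0.
have te : t < expR (- 1) by rewrite (le_lt_trans tM)// ltr_expR ltrN2.
rewrite omega_small// mulrC ler_wpM2l ?(ltW t0)//.
have LM : M <= `|ln t| by apply: ln_ge => //; lra.
rewrite (le_trans (ler_norm K))// (@le_trans _ _ (`|K| + 1)) ?lerDl// ler_wpDr//.
have KE : ((`|K| + 1) `^ alpha^-1) `^ alpha = `|K| + 1.
  by rewrite -powRrM mulVf ?lt0r_neq0// powRr1.
rewrite -[leLHS]KE.
rewrite ge0_ler_powR ?nnegrE ?powR_ge0 ?(ltW alpha_gt0)//.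
by apply: le_trans LM; rewrite /M lerDl.
Qed.

(** With l = |ln t| >= 2 and m = |ln r| >= l, the ratio (m / l)^alpha is at most
(1 + (m - l) / 2)^2, hence at most exp (m - l) = t / r. *)
Lemma mul_ln_powR_homo r t : 0 < r -> r <= t -> t <= expR (- 2) ->
  r * `|ln r| `^ alpha <= t * `|ln t| `^ alpha.
Proof.
move=> r0 rt te; have t0 : 0 < t := lt_le_trans r0 rt.
have l2 : 2 <= `|ln t| by apply: ln_ge.
have e1 : expR (- 2) <= 1 :> R by rewrite expR_le1 oppr_le0.
have t1 := le_trans te e1; have r1 := le_trans rt t1.
pose l := `|ln t|; pose m := `|ln r|.
have lm : l <= m by rewrite /l /m !norm_ln// lerN2 ler_ln.
have l0 : 0 < l by rewrite (lt_le_trans _ l2).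
have rE : r = expR (- m) by rewrite /m norm_ln// opprK lnK.
have tE : t = expR (- l) by rewrite /l norm_ln// opprK lnK.
have q1 : 1 <= m / l by rewrite ler_pdivlMr// mul1r.
have ml : (m / l) `^ alpha <= expR (m - l).
  rewrite (le_trans (ler_powR q1 alpha_le2))// powR_mulrn ?(le_trans ler01 q1)//.
  have -> : expR (m - l) = expR ((m - l) / 2) ^+ 2.
    by rewrite -expRM_natl; congr expR; field.
  rewrite ler_pXn2r// ?nnegrE ?expR_ge0 ?(le_trans ler01 q1)//.
  rewrite (le_trans _ (expR_ge1Dx _))//.
  have -> : m / l = 1 + (m - l) / l by field; rewrite gt_eqF.
  by rewrite lerD2l ler_wpM2l ?subr_ge0// lef_pV2 ?posrE.
have mE : l * (m / l) = m by rewrite mulrC divfK// gt_eqF.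
rewrite -/m -/l -[in leLHS]mE powRM ?(ltW l0) ?(le_trans ler01 q1)// mulrCA mulrC.
rewrite ler_wpM2r ?powR_ge0//.
rewrite (le_trans (ler_wpM2l (ltW r0) ml))// rE tE -expRD.
by rewrite ler_expR; lra.
Qed.

Lemma omega_le_mul_ln r t : 0 <= r -> r <= t -> 0 < t -> t <= expR (- 2) ->
  omega alpha r <= 2 * (t * `|ln t| `^ alpha).
Proof.
move=> r0 rt t0 te.
have [<-|rn0] := eqVneq 0 r.
  by rewrite omega0 !mulr_ge0 ?powR_ge0 ?(ltW t0).
have {rn0}r0 : 0 < r by rewrite lt_neqAle rn0.
have re : r < expR (- 1).
  by rewrite (le_lt_trans (le_trans rt te))// ltr_expR; lra.
have L1 : 1 <= `|ln r| by apply: ln_ge => //; exact: ltW.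
have La : 1 <= `|ln r| `^ alpha by rewrite -(powRr0 `|ln r|) ler_powR// ltW.
have := mul_ln_powR_homo r0 rt te.
have := ler_wpM2l (ltW r0) La.
by rewrite omega_small// mulrDr; lra.
Qed.

Lemma le_mul_ln t : 0 < t -> t <= expR (- 2) -> t <= t * `|ln t| `^ alpha.
Proof.
move=> t0 te; rewrite -[leLHS]mulr1 ler_wpM2l ?(ltW t0)//.
have L2 : 2 <= `|ln t| by apply: ln_ge.
by rewrite -(powRr0 `|ln t|) ler_powR ?(ltW alpha_gt0)//; lra.
Qed.

End omega_estimates.

(** * The almost Lipschitz homeomorphism *)

Lemma l1sum_dist (R : realType) (V W : normedModType R) (y z : l1sum V W) :
  `|y - z| = `|y.1 - z.1| + `|y.2 - z.2|.
Proof. by []. Qed.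

Lemma lin_ker_dist (R : realType) (V : normedModType R) (W : lmodType R)
  (f : {linear V -> W}) (k l : lin_ker f) : `|val k - val l| = `|k - l|.
Proof. by []. Qed.

Section barycentric_splitting.
Context (R : realType) (alpha : R).
Hypothesis alpha_gt0 : 0 < alpha.
Hypothesis alpha_le2 : alpha <= 2.
Local Notation w := (@omega R alpha).
Local Notation F := (lipfree w (c0 R)).
Local Notation beta := (barycentric alpha).
Local Notation G := (l1sum (lin_ker beta) (c0 R)).

Lemma barycentric_delta (x : c0 R) : beta (delta w x) = x.
Proof. exact: (barycentricP alpha).2. Qed.

Lemma barycentric_continuous : continuous beta.
Proof. exact: (barycentricP alpha).1. Qed.

(** On finite combinations each coordinate of the barycenter is the value of a
coordinate functional, which has norm at most 1; the general case follows by
continuity. *)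
Lemma barycentric_norm (z : F) : `|beta z| <= `|z|.
Proof.
have [w_ge w_le] := omega_gauge alpha_le2.
have /linear_bounded_continuous/linear_boundedP/pinfty_ex_gt0[M M0 betaM] :=
  barycentric_continuous.
apply/ler_addgt0Pr => e e0; have M1 : 0 < M + 1 by rewrite addr_gt0.
have [n [a [x]]] := lipfree_approx z (divr_gt0 e0 M1).
set u := \sum_(i < n) _ => zu.
have bu : `|beta u| <= `|u|.
  apply: c0_norm_le => k; have -> : (beta u) k = u (Defs.coord alpha k).
    rewrite lipfree_act_sum linear_sum.
    elim/big_ind2: _ => // [y b y' b' <- <- //|i _].
    by rewrite linearZ/= barycentric_delta.
  rewrite -[leRHS]mul1r lipfree_act_le// => y y'; rewrite mul1r.
  by rewrite (le_trans _ (w_ge _ (normr_ge0 _)))// (c0_coord_le (y - y') k).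
rewrite -(subrK u z) linearD (le_trans (ler_normD _ _))//.
have := betaM (z - u); have := ler_normB z (z - u); rewrite subKr => ? ?.
have : (M + 1) * `|z - u| <= e by rewrite mulrC -ler_pdivlMr// ltW.
by rewrite subrK; lra.
Qed.

Fact splitting_in_ker (z : F) : z - delta w (beta z) \in lin_ker_pred beta.
Proof.
by apply/mem_set => /=; rewrite linearB/= barycentric_delta subrr.
Qed.

Definition splitting (z : F) : G := (LinKer (splitting_in_ker z), beta z).

Definition merging (y : G) : F := val y.1 + delta w y.2.

Lemma splittingK : cancel splitting merging.
Proof. by move=> z; rewrite /merging /= subrK. Qed.

Lemma mergingK : cancel merging splitting.
Proof.
move=> [k x]; rewrite /splitting /merging /=.
have bkx : beta (val k + delta w x) = x.
  by rewrite linearD barycentric_delta; have /set_mem/= -> := lin_ker_valP k; rewrite add0r.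
by congr pair; [apply: val_inj; rewrite /= bkx addrK|].
Qed.

(** A modulus of continuity bounded by 2 t + omega t, with omega evaluated at the
distance r <= t of the c_0 components. *)
Definition gauge_modulus (V W : normedModType R) (f : V -> W) :=
  forall u v, exists r, [/\ 0 <= r, r <= `|u - v| &
    `|f u - f v| <= 2 * `|u - v| + w r].

Lemma splitting_modulus : gauge_modulus splitting.
Proof.
have [w_ge w_le] := omega_gauge alpha_le2.
move=> y z; exists `|beta y - beta z|; split=> //.
  by rewrite -linearB barycentric_norm.
rewrite l1sum_dist -lin_ker_dist /=.
have -> : y - delta w (beta y) - (z - delta w (beta z)) =
    (y - z) - (delta w (beta y) - delta w (beta z)).
  by rewrite opprD addrACA -opprD.
have := ler_normB (y - z) (delta w (beta y) - delta w (beta z)).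
have := delta_dist w_ge (beta y) (beta z).
have : `|beta y - beta z| <= `|y - z| by rewrite -linearB barycentric_norm.
lra.
Qed.

Lemma merging_modulus : gauge_modulus merging.
Proof.
have [w_ge w_le] := omega_gauge alpha_le2.
move=> y z; exists `|y.2 - z.2|.
have y1z : 0 <= `|y.1 - z.1| by [].
have y2z : 0 <= `|y.2 - z.2| by [].
rewrite l1sum_dist; split; [by []|by rewrite lerDr|].
rewrite /merging opprD addrACA (le_trans (ler_normD _ _))// lerD//.
  by rewrite lin_ker_dist; lra.
exact: delta_dist.
Qed.

Lemma gauge_modulus_almost_lipschitz (V W : normedModType R) (f : V -> W) :
  gauge_modulus f ->
  almost_lipschitz alpha f.
Proof.
move=> fw; exists 4, (expR (- 2)); split=> [||t /andP[t0 te]]; [by []|exact: expR_gt0|].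
apply: ge_ereal_sup => _ [[u v] /= uvt <-].
rewrite lee_fin; have [r [r0 ruv fuv]] := fw u v.
have := omega_le_mul_ln alpha_gt0 alpha_le2 r0 (le_trans ruv uvt) t0 te.
by have := le_mul_ln alpha_gt0 t0 te; lra.
Qed.

Lemma gauge_modulus_continuous (V W : normedModType R) (f : V -> W) :
  gauge_modulus f -> continuous f.
Proof.
have [w_ge w_le] := omega_gauge alpha_le2.
move=> fw v; apply/cvgrPdist_le => e e0; have e20 : 0 < e / 2 by rewrite divr_gt0.
have [d d0 wd] := gauge_small w_le e20.
have m0 : 0 < Num.min d (e / 4) by rewrite lt_min d0 divr_gt0.
apply/nbhs_ballP; exists (Num.min d (e / 4)) => //= u.
rewrite -ball_normE/= lt_min => /andP[vud vue].
have [r [r0 rvu fvu]] := fw v u.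
by have := wd r r0 (le_lt_trans rvu vud); lra.
Qed.

End barycentric_splitting.

Lemma lipschitzE (R : realType) (V W : normedModType R) (f : V -> W) :
  lipschitz f -> exists2 L : R, 0 < L & forall x y, `|f x - f y| <= L * `|x - y|.
Proof.
by move=> /pinfty_ex_gt0[L L0 fL]; exists L => // x y; exact: (fL (x, y)).
Qed.

Theorem theorem5p5 (R : realType) (alpha : R) :
  0 < alpha -> alpha <= 2 ->
  let F : normedModType R := lipfree (omega alpha) (c0 R) in
  let G : normedModType R := l1sum (lin_ker (barycentric alpha)) (c0 R) in
  [/\ banach F /\ separable F,
      banach G /\ separable G,
      almost_lipschitz_homeomorphic alpha alpha F G &
      ~ lipschitz_homeomorphic F G].
Proof.
move=> a0 a2 F G; have wg := omega_gauge a2; have [w_ge w_le] := wg.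
have dF : exists d : nat -> F, dense_sequence d.
  exact: lipfree_dense_sequence w_ge w_le (c0_dense_sequence R).
have dG : exists d : nat -> G, dense_sequence d.
  apply: (dense_sequence_image _ _ dF (f := splitting (alpha := alpha))).
    exact/gauge_modulus_continuous/splitting_modulus.
  by move=> y; exists (merging y); exact: mergingK.
split.
- split; first exact: banach_lipfree.
  by have [d /dense_sequence_separable] := dF.
- split; last by have [d /dense_sequence_separable] := dG.
  apply: banach_l1sum; last exact: banach_c0.
  by apply: banach_lin_ker; [exact: barycentric_continuous|exact: banach_lipfree].
- exists (@splitting R alpha), (@merging R alpha).
  split; [exact: splittingK|exact: mergingK| |].
    exact/gauge_modulus_almost_lipschitz/splitting_modulus.
  exact/gauge_modulus_almost_lipschitz/merging_modulus.
- move=> [f [g [_ fg /lipschitzE[Lf Lf0 fL] /lipschitzE[Lg _ gL]]]].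
  pose i x : G := (0, x); pose h x := g (i x).
  have iE x y : `|i x - i y| = `|x - y|.
    by rewrite l1sum_dist /= subrr normr0 add0r.
  apply: (@c0_not_lipschitz_embeddable R _ _ h Lg Lf^-1 wg (omega_steep a0)).
  + by move=> x y; rewrite -iE; exact: gL.
  + by rewrite invr_gt0.
  + by move=> x y; rewrite ler_pdivrMl// -iE -{1}(fg (i x)) -{1}(fg (i y)); exact: fL.
Qed.
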